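(* Let $G=(V,E)$ be a directed graph on $n$ vertices with target vertex $t\in V$, let $\varepsilon\in[0,1]$, and suppose at most $h$ vertices of $G$ have in-degree or out-degree above $(1-\varepsilon)n$. Let $r\in[0,1]$, and suppose $A$ is a (randomized) algorithm in the graph-access model that, on input $G$, outputs an estimate of $\pi_G(t)$ in expected time $O\!\left(\min\{T_r,\ r/\pi_G(t)\}\,(\varepsilon^2/(h^2+1))/\log^{3/2} n\right)$. Then one can construct a directed graph $G^+$ on the same vertex set (containing $t$) such that $$\pi_{G^+}(t)=\omega(\pi_G(t)) \quad\text{and}\quad \Pr_R\left\{\hat{\pi}_{A_R(G^+)}(t)=\hat{\pi}_{A_R(G)}(t)\right\}\ge 1-o(1),$$ where the probability is over the random seed $R$ of $A$.
   Context: Fix a constant $\alpha\in(0,1)$. An $\alpha$-discounted random walk from a vertex $s$: at each step it terminates with probability $\alpha$, and otherwise moves to a uniformly random out-neighbor of the current vertex; if the current vertex has no out-neighbors, the walk terminates. $\pi(s,t)$ is the probability that such a walk from $s$ terminates at $t$, and $\pi(t)=\sum_{v\in V}\pi(v,t)/n$; subscripts denote the graph. For $r\in[0,1]$, $V_r=\{v\in V:\pi(v,t)\ge r\}$ and $T_r=\sum_{v\in V_r}(1+d_{\mathrm{in}}(v))$, where $d_{\mathrm{in}}$ is in-degree. Graph-access model: the algorithm accesses the graph only via unit-time oracle queries returning the in-degree or out-degree of a vertex, the $i$-th in-neighbor or $i$-th out-neighbor of a vertex, a uniformly random vertex; additionally adjacency queries $\mathrm{adj}(u,v)$ and queries returning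 the $i$-th vertex that is not an in-neighbor (resp. not an out-neighbor) of $v$ are allowed. $\hat\pi_{A_R(H)}(t)$ denotes the output of $A$ run with random seed $R$ on graph $H$. $n$ is known; asymptotic notation is with respect to $n\to\infty$, with $\alpha$ fixed. *)

(* Defs.v *)
From HB Require Import structures.
From mathcomp Require Import all_boot all_order all_algebra.
From mathcomp Require Import all_classical all_reals all_analysis.

Set Implicit Arguments.
Unset Strict Implicit.
Unset Printing Implicit Defensive.

Import Order.TTheory GRing.Theory Num.Theory.
Import numFieldNormedType.Exports.

Local Open Scope classical_set_scope.
Local Open Scope ring_scope.

(* A directed graph (arc set included in V * V) as presented to an algorithm:
   the neighbour queries refer to the i-th entry of adjacency lists, so the
   order of these lists, which is arbitrary, is part of the input. *)
Record digraph (n : nat) := Digraph {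
  arc :> rel 'I_n;
  in_list : 'I_n -> seq 'I_n;
  out_list : 'I_n -> seq 'I_n;
  nonin_list : 'I_n -> seq 'I_n;
  nonout_list : 'I_n -> seq 'I_n;
  in_listP : forall v, perm_eq (in_list v) [seq u <- enum 'I_n | arc u v];
  out_listP : forall v, perm_eq (out_list v) [seq u <- enum 'I_n | arc v u];
  nonin_listP :
    forall v, perm_eq (nonin_list v) [seq u <- enum 'I_n | ~~ arc u v];
  nonout_listP :
    forall v, perm_eq (nonout_list v) [seq u <- enum 'I_n | ~~ arc v u]
}.

Definition indeg n (G : digraph n) (v : 'I_n) : nat := #|[pred u | G u v]|.
Definition outdeg n (G : digraph n) (v : 'I_n) : nat := #|[pred u | G v u]|.

Section PageRank.
Variables (R : realType) (alpha : R) (n : nat) (G : digraph n).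

Definition step_prob (u v : 'I_n) : R :=
  if G u v then (1 - alpha) / (outdeg G u)%:R else 0.

Definition stop_prob (u : 'I_n) : R :=
  if outdeg G u == 0%N then 1 else alpha.

(* Probability that the walk from s makes at least l moves and that the l-th
   one leads to v. *)
Fixpoint walk_prob (l : nat) (s v : 'I_n) : R :=
  if l is l'.+1 then \sum_(u < n) walk_prob l' s u * step_prob u v
  else (s == v)%:R.

Definition ppr (s t : 'I_n) : R :=
  limn (series (fun l => walk_prob l s t * stop_prob t)).

Definition pagerank (t : 'I_n) : R := \sum_(v < n) ppr v t / n%:R.

Definition in_volume (r : R) (t : 'I_n) : nat :=
  (\sum_(v < n | (r <= ppr v t)%R) (1 + indeg G v))%N.

End PageRank.

Inductive query (n : nat) :=
  | InDegree of 'I_n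
  | OutDegree of 'I_n
  | InNeighbor of 'I_n & nat
  | OutNeighbor of 'I_n & nat
  | RandomVertex
  | Adjacent of 'I_n & 'I_n
  | NonInNeighbor of 'I_n & nat
  | NonOutNeighbor of 'I_n & nat.
Arguments RandomVertex {n}.

Inductive answer (n : nat) :=
  | ANat of nat
  | AVertex of option 'I_n
  | ABool of bool.
Arguments ANat {n}.
Arguments ABool {n}.

Inductive action (R : realType) (n : nat) :=
  | Ask of query n
  | Output of R.
Arguments Ask {R n}.
Arguments Output {R n}.

(* List positions start at 0; a position past the end is answered by None.
   x is the vertex that a random-vertex query would return. *)
Definition reply n (G : digraph n) (x : 'I_n) (q : query n) : answer n :=
  match q with
  | InDegree v => ANat (indeg G v)
  | OutDegree v => ANat (outdeg G v)
  | InNeighbor v i => AVertex (onth (in_list G v) i)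
  | OutNeighbor v i => AVertex (onth (out_list G v) i)
  | RandomVertex => AVertex (Some x)
  | Adjacent u v => ABool (G u v)
  | NonInNeighbor v i => AVertex (onth (nonin_list G v) i)
  | NonOutNeighbor v i => AVertex (onth (nonout_list G v) i)
  end.

Section Run.
Variables (R : realType) (n : nat).
(* A deterministic adaptive strategy chooses its next action from the answers
   received so far; it need not halt. *)
Variables (strat : seq (answer n) -> action R n) (G : digraph n).
Variable xi : nat -> 'I_n.

Fixpoint transcript (j : nat) : seq (answer n) :=
  if j is j'.+1 then
    let hist := transcript j' in
    match strat hist with
    | Ask q => rcons hist (reply G (xi j') q)
    | Output _ => hist
    end
  else [::].

Definition asks (j : nat) : bool :=
  if strat (transcript j) is Ask _ then true else false.

Definition outputs (y : R) : Prop := exists j, strat (transcript j) = Output y.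

(* One unit per query and one for producing the output; +oo without halting. *)
Definition run_time : \bar R := (1 + \sum_(0 <= j <oo) (asks j)%:R%:E)%E.

End Run.

(* A seed carries the internal randomness of the algorithm and the vertices
   rand_vertex j returned if a random-vertex query is made at step j.
   seed_indep says that these vertices are i.i.d. uniform and independent of
   the internal randomness, which is all that the strategy has access to. *)
Record algorithm (R : realType) (n : nat) := Algorithm {
  seed_disp : measure_display;
  seed : measurableType seed_disp;
  seed_law : probability seed R;
  coin_disp : measure_display;
  coin_space : measurableType coin_disp;
  coins : seed -> coin_space;
  rand_vertex : nat -> seed -> 'I_n;
  strategy : coin_space -> seq (answer n) -> action R n;
  coins_meas : measurable_fun setT coins;
  rand_vertex_meas : forall j v, measurable [set w | rand_vertex j w = v];
  seed_indep : forall (B : set coin_space) (m : nat) (v : nat -> 'I_n),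
    measurable B ->
    seed_law (coins @^-1` B `&`
              [set w | forall j, (j < m)%N -> rand_vertex j w = v j])
    = (seed_law (coins @^-1` B) * (n%:R^-1 ^+ m)%:E)%E;
  strategy_ask_meas :
    forall hist q, measurable [set c | strategy c hist = Ask q];
  strategy_output_meas : forall hist (B : set R), measurable B ->
    measurable [set c | exists2 y, B y & strategy c hist = Output y]
}.

Section Execution.
Variables (R : realType) (n : nat) (A : algorithm R n) (G : digraph n).

Definition seed_outputs (w : seed A) (y : R) : Prop :=
  outputs (strategy (coins w)) G (fun j => rand_vertex j w) y.

Definition expected_time : \bar R :=
  (\int[seed_law A]_w
     run_time (strategy (coins w)) G (fun j => rand_vertex j w))%E.

End Execution.

Definition same_output_prob (R : realType) (n : nat) (A : algorithm R n)
    (G H : digraph n) : \bar R :=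
  seed_law A [set w | exists y, seed_outputs G w y /\ seed_outputs H w y].

(* Main.v *)
Require Import Defs.
From HB Require Import structures.
From mathcomp Require Import all_boot all_order all_algebra.
From mathcomp Require Import all_classical all_reals all_analysis.
From mathcomp Require Import measurable_realfun.
From mathcomp Require Import ring lra.

Set Implicit Arguments.
Unset Strict Implicit.
Unset Printing Implicit Defensive.

Import Order.TTheory GRing.Theory Num.Theory.
Import numFieldNormedType.Exports.

Local Open Scope classical_set_scope.
Local Open Scope ring_scope.

(* Pick a random set B of about (s + log n) / eps vertices, split it into a hub
   x, a set S0 of s feeders and a set S' of absorbers, and let S0 point to x and
   x point to a vertex v with ppr(v, t) >= r.  A vertex w of in-degree at most
   (1 - eps) n has many non-in-neighbours in S' (Chernoff), so the arcs that w
   loses from S0 and x can be replaced by arcs from S' without changing the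
   in-degree of w.  The extra arc (x, v) is hidden in one of two ways.  Either
   V_r has at least T_r / (2 (h + 1)) vertices, and a random v in V_r is rarely
   queried at all; or there are at least T_r / 2 arcs (y, v) into V_r from
   vertices y of moderate out-degree, and for a random one y -> v is traded for
   y -> z with z in B.  A reply on G then differs only for a query that mentions
   an element of B or the chosen item, so averaging the run on G over all
   choices bounds the detection probability by (2 |B| / n + 1 / #items) E[time].
   The walks from v that reach t lose little by avoiding B and (y, v), since
   they visit O(log n) vertices on average.  Hence the PageRank of t becomes at
   least of order (s / n) r / (h + 1)^2, and s is chosen to make this
   (log n)^(1/4) times the old value. *)

(** * Truncated personalized PageRank and avoiding a set of vertices *)

(** The hub exists because only one unit of in-degree of [v] can be traded away: feeders pointing to
    [v] directly would raise its in-degree by s. Vertices of high in-degree are the obstacle. They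
    may have too few non-in-neighbours to replace lost arcs, so the hub and the feeders keep their
    arcs into them and have out-degree up to h + 1. This costs a factor 1 / (h + 1) in each of the
    two hops, whence h^2 + 1 in the time bound. The term log n in the size of B pays for a union
    bound over 2n neighbourhoods. With lam = (log n)^(1/4) the exponent 3/2 is lam^6: walks of
    length about lam^4 must miss the part of B forced by s = lam n (h^2 + 1) pi / r, which uses up
    lam^5 and leaves one factor lam to swallow constants. Every run costs at least one unit, so the
    time bound itself is at least 1; this yields eps, r, T_r > 0 and a lower bound on eps^2 n. *)

Section Walks.
Variables (R : realType) (alpha : R) (n : nat) (G : digraph n) (t : 'I_n).
Hypotheses (alpha_gt0 : 0 < alpha) (alpha_lt1 : alpha < 1).

Local Ltac alra := move: alpha_gt0 alpha_lt1; lra.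

Local Notation P := (step_prob alpha G).

Lemma step_prob_ge0 u v : 0 <= P u v.
Proof.
rewrite /step_prob; case: ifP => // _; rewrite divr_ge0 ?ler0n //; alra.
Qed.

Lemma sum_step_prob u :
  \sum_v P u v = if outdeg G u == 0%N then 0 else 1 - alpha.
Proof.
rewrite /step_prob -big_mkcond sumr_const /outdeg.
case: ifP => [/eqP ->|H0]; first by rewrite mulr0n.
rewrite -[_ *+ _]mulr_natr divfK // pnatr_eq0.
by rewrite H0.
Qed.

Lemma sum_step_prob_le u : \sum_v P u v <= 1 - alpha.
Proof. by rewrite sum_step_prob; case: ifP => // _; alra. Qed.

Lemma step_prob_le u v : P u v <= 1 - alpha.
Proof.
apply: le_trans (sum_step_prob_le u); rewrite (bigD1 v) //= lerDl.
by apply: sumr_ge0 => w _; apply: step_prob_ge0.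
Qed.

Lemma stop_prob_ge u : alpha <= stop_prob alpha G u.
Proof. by rewrite /stop_prob; case: ifP => // _; alra. Qed.

Lemma stop_prob_ge0 u : 0 <= stop_prob alpha G u.
Proof. by apply: le_trans (stop_prob_ge u); alra. Qed.

(** [walk_prob] peels off the last move; the recursions below fix the target and need the first move
    peeled off instead. *)
Lemma walk_probSl l s v :
  walk_prob alpha G l.+1 s v = \sum_u P s u * walk_prob alpha G l u v.
Proof.
elim: l v => [|l IHl] v.
  rewrite /= (bigD1 s) //= eqxx mul1r big1 ?addr0; last first.
    by move=> u /negPf; rewrite eq_sym => ->; rewrite mul0r.
  rewrite (bigD1 v) //= eqxx mulr1 big1 ?addr0 // => u /negPf ->.
  by rewrite mulr0.
rewrite -[LHS]/(\sum_w walk_prob alpha G l.+1 s w * P w v).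
under eq_bigr do rewrite IHl mulr_suml.
rewrite exchange_big; apply: eq_bigr => u _ /=.
by rewrite mulr_sumr; apply: eq_bigr => w _; rewrite mulrA.
Qed.

Definition start_stop (s : 'I_n) : R := (s == t)%:R * stop_prob alpha G t.

Lemma start_stop_ge0 s : 0 <= start_stop s.
Proof. by rewrite mulr_ge0 // stop_prob_ge0. Qed.

Definition ppr_trunc (i : nat) (s : 'I_n) : R :=
  series (fun l => walk_prob alpha G l s t * stop_prob alpha G t) i.

Lemma ppr_trunc0 s : ppr_trunc 0 s = 0.
Proof. by rewrite /ppr_trunc /series /= big_geq. Qed.

Lemma ppr_truncS i s :
  ppr_trunc i.+1 s = start_stop s + \sum_u P s u * ppr_trunc i u.
Proof.
rewrite /ppr_trunc /series /= big_nat_recl //=; congr (_ + _).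
under eq_bigr => l _.
  rewrite -[X in X * _]/(walk_prob alpha G l.+1 s t) walk_probSl mulr_suml.
  over.
rewrite exchange_big; apply: eq_bigr => u _ /=.
by rewrite mulr_sumr; apply: eq_bigr => l _; rewrite mulrA.
Qed.

Lemma ppr_trunc_ge0 i s : 0 <= ppr_trunc i s.
Proof.
elim: i s => [|i IHi] s; first by rewrite ppr_trunc0.
rewrite ppr_truncS addr_ge0 ?start_stop_ge0 // sumr_ge0 // => u _.
by rewrite mulr_ge0 ?step_prob_ge0.
Qed.

(** Stopping at [t] and moving on from it have total probability 1, so the recursion preserves the
    bound. With monotonicity this makes the limit in [ppr] a genuine one. *)
Lemma ppr_trunc_le1 i s : ppr_trunc i s <= 1.
Proof.
elim: i s => [|i IHi] s; first by rewrite ppr_trunc0.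
rewrite ppr_truncS.
apply: (@le_trans _ _ (start_stop s + \sum_u P s u)).
  rewrite lerD2l; apply: ler_sum => u _.
  by rewrite ler_piMr ?step_prob_ge0.
rewrite sum_step_prob /start_stop.
case: eqP => [->|_]; rewrite ?mul1r ?mul0r /stop_prob; case: ifP => _; alra.
Qed.

Lemma ppr_trunc_leS i s : ppr_trunc i s <= ppr_trunc i.+1 s.
Proof.
elim: i s => [|i IHi] s; first by rewrite ppr_trunc0 ppr_trunc_ge0.
rewrite ppr_truncS [leRHS]ppr_truncS lerD2l; apply: ler_sum => u _.
by rewrite ler_wpM2l ?step_prob_ge0.
Qed.

Lemma ppr_trunc_nondecreasing s :
  nondecreasing_seq (fun i => ppr_trunc i s).
Proof. by apply/nondecreasing_seqP => i; apply: ppr_trunc_leS. Qed.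

Lemma cvg_ppr_trunc s : ppr_trunc^~ s @ \oo --> ppr alpha G s t.
Proof.
apply: nondecreasing_is_cvgn; first exact: ppr_trunc_nondecreasing.
by exists 1 => _ [i _ <-]; apply: ppr_trunc_le1.
Qed.

Lemma ppr_trunc_le i s : ppr_trunc i s <= ppr alpha G s t.
Proof.
apply: (@nondecreasing_cvgn_le _ (ppr_trunc^~ s)).
  exact: ppr_trunc_nondecreasing.
by apply/cvg_ex; eexists; apply: cvg_ppr_trunc.
Qed.

Lemma ppr_ge0 s : 0 <= ppr alpha G s t.
Proof. exact: le_trans (ppr_trunc_ge0 0 s) (ppr_trunc_le 0 s). Qed.

Lemma ppr_le1 s : ppr alpha G s t <= 1.
Proof.
apply: limr_le; first by apply/cvg_ex; eexists; apply: cvg_ppr_trunc.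
by apply: nearW => i; apply: ppr_trunc_le1.
Qed.

Lemma pprE s :
  ppr alpha G s t = start_stop s + \sum_u P s u * ppr alpha G u t.
Proof.
have H1 : (fun i => ppr_trunc i.+1 s) @ \oo --> ppr alpha G s t.
  by rewrite (cvg_shiftS (ppr_trunc^~ s)); exact: cvg_ppr_trunc.
have H2 : (fun i => ppr_trunc i.+1 s) @ \oo -->
    start_stop s + \sum_u P s u * ppr alpha G u t.
  under eq_fun do rewrite ppr_truncS.
  apply: cvgD; first exact: cvg_cst.
  apply: (cvg_big add_continuous) => u _; apply: cvgMl_tmp.
  exact: cvg_ppr_trunc.
exact: cvg_unique H1 H2.
Qed.

(** A walk survives i moves with probability at most (1 - alpha)^i and contributes at most 1
    afterwards. *)
Lemma ppr_trunc_tail i s :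
  ppr alpha G s t <= ppr_trunc i s + (1 - alpha) ^+ i.
Proof.
elim: i s => [|i IHi] s; first by rewrite ppr_trunc0 add0r expr0 ppr_le1.
rewrite pprE ppr_truncS -addrA lerD2l.
apply: (@le_trans _ _ (\sum_u (P s u * ppr_trunc i u +
    P s u * (1 - alpha) ^+ i))).
  by apply: ler_sum => u _; rewrite -mulrDr ler_wpM2l ?step_prob_ge0.
rewrite big_split /= lerD2l -mulr_suml exprS ler_wpM2r ?sum_step_prob_le //.
by rewrite exprn_ge0 //; alra.
Qed.

Lemma ppr_step s u : P s u * ppr alpha G u t <= ppr alpha G s t.
Proof.
rewrite [leRHS]pprE (bigD1 u) //= addrCA lerDl addr_ge0 ?start_stop_ge0 //.
by apply: sumr_ge0 => w _; rewrite mulr_ge0 ?step_prob_ge0 ?ppr_ge0.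
Qed.

(** The walk from [t] may stop at once. This makes the PageRank positive and caps r / pi at n /
    alpha. *)
Lemma pagerank_ge : alpha / n%:R <= pagerank alpha G t.
Proof.
rewrite /pagerank (bigD1 t) //= -[leLHS]addr0 lerD //.
  rewrite ler_wpM2r ?invr_ge0 ?ler0n //.
  rewrite pprE -[leLHS]addr0 lerD // ?sumr_ge0 // => [|u _].
    by rewrite /start_stop eqxx mul1r stop_prob_ge.
  by rewrite mulr_ge0 ?step_prob_ge0 ?ppr_ge0.
by apply: sumr_ge0 => w _; rewrite divr_ge0 ?ppr_ge0 ?ler0n.
Qed.

(* Value iteration for a nonnegative kernel Q, and the part of it that is
   carried by walks through b. *)
Fixpoint value (Q : 'I_n -> 'I_n -> R) (i : nat) (s : 'I_n) : R :=
  if i is j.+1 then start_stop s + \sum_u Q s u * value Q j u else 0.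

Fixpoint value_via (Q : 'I_n -> 'I_n -> R) (b : 'I_n) (i : nat) (s : 'I_n)
    : R :=
  if i is j.+1 then
    (s == b)%:R * value Q i b + \sum_u Q s u * value_via Q b j u
  else 0.

Section Kernel.
Variable Q : 'I_n -> 'I_n -> R.
Hypothesis Q_ge0 : forall u v, 0 <= Q u v.

Lemma value_ge0 i s : 0 <= value Q i s.
Proof.
elim: i s => //= i IHi s; rewrite addr_ge0 ?start_stop_ge0 //.
by apply: sumr_ge0 => u _; rewrite mulr_ge0.
Qed.

Lemma value_via_ge0 b i s : 0 <= value_via Q b i s.
Proof.
elim: i s => // i IHi s; apply: addr_ge0.
  by rewrite mulr_ge0 // value_ge0.
by apply: sumr_ge0 => u _; rewrite mulr_ge0.
Qed.

(* A walk of fewer than i moves visits at most i vertices. *)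
Lemma sum_value_via i s :
  \sum_b value_via Q b i s <= i%:R * value Q i s.
Proof.
elim: i s => [|i IHi] s; first by rewrite big1 // mul0r.
rewrite [leLHS](_ : _ = value Q i.+1 s +
    \sum_u Q s u * \sum_b value_via Q b i u); last first.
  rewrite big_split; congr (_ + _).
    rewrite (bigD1 s) //= eqxx mul1r [X in _ + X]big1 ?addr0 // => b /negPf.
    by rewrite eq_sym => ->; rewrite mul0r.
  by rewrite exchange_big; apply: eq_bigr => u _ /=; rewrite mulr_sumr.
rewrite -natr1 mulrDl mul1r addrC lerD2r.
apply: (@le_trans _ _ (i%:R * \sum_u Q s u * value Q i u)).
  rewrite mulr_sumr; apply: ler_sum => u _.
  by rewrite mulrCA ler_wpM2l.
by rewrite ler_wpM2l ?ler0n //= lerDr start_stop_ge0.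
Qed.

(** A union bound: [value_via] counts a walk once per visit, so the subtraction removes at least all
    walks that meet [B]. On [B] the left side is at most 0 and positivity of [F] suffices; hence [F]
    may be the [ppr] of a graph whose rows in [B] are arbitrary. *)
Lemma value_avoid (B : {set 'I_n}) (F : 'I_n -> R) :
  (forall s, 0 <= F s) ->
  (forall s, s \notin B -> start_stop s + \sum_u Q s u * F u <= F s) ->
  forall i s, value Q i s - \sum_(b in B) value_via Q b i s <= F s.
Proof.
move=> F_ge0 F_super; elim=> [|i IHi] s.
  by rewrite /= big1 // subr0.
have [sB|sB] := boolP (s \in B).
  apply: le_trans (F_ge0 s); rewrite subr_le0 (bigD1 s) //=.
  rewrite eqxx mul1r -addrA lerDl addr_ge0 //.
    by apply: sumr_ge0 => u _; rewrite mulr_ge0 // value_via_ge0.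
  apply: sumr_ge0 => b _; exact: (value_via_ge0 b i.+1).
apply: le_trans (F_super s sB).
rewrite [X in _ - X](_ : _ =
    \sum_u Q s u * \sum_(b in B) value_via Q b i u); last first.
  rewrite big_split /= big1 ?add0r; last first.
    by move=> b bB; rewrite (_ : s == b = false) ?mul0r //;
       apply: contraNF sB => /eqP ->.
  by rewrite exchange_big; apply: eq_bigr => u _ /=; rewrite mulr_sumr.
rewrite /= -addrA lerD2l -sumrB; apply: ler_sum => u _.
by rewrite -mulrBr ler_wpM2l.
Qed.

End Kernel.

(** The deleted mass is not redistributed: [y] will keep its out-degree, the arc to [v] being traded
    for one into the avoided set. *)
Definition del_step (d : bool) (y v : 'I_n) (s u : 'I_n) : R :=
  if [&& d, s == y & u == v] then 0 else P s u.

Lemma del_step_ge0 d y v s u : 0 <= del_step d y v s u.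
Proof. by rewrite /del_step; case: ifP => // _; apply: step_prob_ge0. Qed.

(* At v itself deleting an arc into v costs at most a factor alpha, because a
   walk returns to v with probability at most 1 - alpha. *)
Lemma value_del_step d y v i s :
  ppr_trunc i s - (1 - alpha) * ppr alpha G v t
    <= value (del_step d y v) i s.
Proof.
have a_ge0 := ppr_ge0 v.
elim: i s => [|i IHi] s.
  rewrite /= ppr_trunc0 sub0r oppr_le0 mulr_ge0 //; alra.
rewrite ppr_truncS /= -addrA lerD2l.
set a := ppr alpha G v t in a_ge0 IHi *.
apply: (@le_trans _ _ (\sum_u del_step d y v s u *
    (ppr_trunc i u - (1 - alpha) * a))); last first.
  by apply: ler_sum => u _; rewrite ler_wpM2l ?del_step_ge0.
have Ptr_le := ppr_trunc_le i v.
have S_le := sum_step_prob_le s.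
have P0 := step_prob_ge0 s v; have P1 := step_prob_le s v.
have [/andP[dT /eqP sy]|dF] := boolP (d && (s == y)); last first.
  rewrite [leRHS](eq_bigr (fun u =>
      P s u * ppr_trunc i u - P s u * ((1 - alpha) * a))); last first.
    move=> u _; rewrite /del_step andbA (negPf dF) /=; ring.
  rewrite sumrB -mulr_suml lerD2l lerN2.
  rewrite ler_piMl ?mulr_ge0 //; alra.
rewrite (bigD1 v) //= [X in _ <= X](bigD1 v) //=.
rewrite {1}/del_step dT sy !eqxx /= mul0r add0r -sy.
rewrite [leRHS](eq_bigr (fun u =>
    P s u * ppr_trunc i u - P s u * ((1 - alpha) * a))); last first.
  move=> u uv; rewrite /del_step (negPf uv) !andbF; ring.
rewrite sumrB -mulr_suml addrAC [leRHS]addrC lerD2r.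
move: S_le; rewrite (bigD1 v) //=; set S := \sum_(i < n | _) _ => S_le.
(* With p = [P s v] the total loss is at most a (p + (1 - alpha - p)(1 - alpha)) = a ((1 - alpha)^2
   + alpha p), and p <= 1 - alpha brings it down to (1 - alpha) a. *)
have H1 : P s v * ppr_trunc i v <= P s v * a by rewrite ler_wpM2l.
have H2 : S * ((1 - alpha) * a) <= (1 - alpha - P s v) * ((1 - alpha) * a).
  by rewrite ler_wpM2r ?mulr_ge0 //; alra.
have H3 : P s v * (alpha * a) <= (1 - alpha) * (alpha * a).
  by rewrite ler_wpM2r // mulr_ge0 //; alra.
alra.
Qed.

End Walks.

(** * Rewiring a graph while keeping adjacency list positions *)

(** Common entries stay in place and the gaps receive the new ones. A changed position thus held an
    entry that has left the list, never one that merely shifted. *)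
Lemma relist (T : eqType) (l m : seq T) : uniq l -> uniq m -> size l = size m ->
  exists2 l', perm_eq l' m &
    forall i, onth l i <> onth l' i -> exists2 x, onth l i = Some x & x \notin m.
Proof.
elim: l m => [|a l IHl] m /=; first by move=> _ _ /esym/size0nil ->; exists [::].
move=> /andP[al l_uniq] m_uniq szm.
(* The head is kept if it survives; otherwise its place goes to an entry that is new, so that no
   later survivor loses its position. *)
pose good x := (x \in m) && ((x == a) || (x \notin a :: l) && (a \notin m)).
have [x /andP[xm xgood]] : exists x, good x.
  have [am|am] := boolP (a \in m).
    by exists a; rewrite /good am eqxx.
  have [lm|/allPn[x xm xl]] := boolP (all (mem (a :: l)) m); last first.
    by exists x; rewrite /good xm am [_ \notin _]xl orbT.
  (* Were [m] contained in [a :: l], equal sizes would force equal sets, contrary to [a] not being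
     in [m]. *)
  have [] := uniq_min_size m_uniq (fun x => allP lm x); rewrite /= ?szm //.
  by move=> _ /(_ a); rewrite (negPf am) inE eqxx.
have mx := perm_to_rem xm.
have [l' l'm H] : exists2 l', perm_eq l' (rem x m) &
    forall i, onth l i <> onth l' i ->
    exists2 x0, onth l i = Some x0 & x0 \notin rem x m.
  by apply: IHl => //; rewrite ?rem_uniq // size_rem // -szm.
exists (x :: l'); first by rewrite perm_sym (perm_trans mx) // perm_cons perm_sym.
case=> [|i] /=.
  case/orP: xgood => [/eqP -> //|/andP[_ am] _]; by exists a.
move=> /H[u lu um]; exists u => //; apply: contraNN um => um.
rewrite mem_rem_uniq // inE um andbT.
have ul : u \in l by apply/onthP; exists i.
case/orP: xgood => [/eqP ->|/andP[xl _]].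
  by apply: contraNneq al => <-.
by apply: contraNneq xl => <-; rewrite inE ul orbT.
Qed.

(** Equal size is demanded only for stability, because vertices whose degree changes still need some
    list. *)
Lemma relist_pred n (P P' : pred 'I_n) (l : seq 'I_n) :
  perm_eq l [seq u <- enum 'I_n | P u] ->
  exists2 l', perm_eq l' [seq u <- enum 'I_n | P' u] &
    #|P| = #|P'| -> forall i, onth l i <> onth l' i ->
    exists2 u, onth l i = Some u & P u && ~~ P' u.
Proof.
move=> lP; have [PP'|NPP'] := eqVneq #|P| #|P'|; last first.
  by exists [seq u <- enum 'I_n | P' u] => // PP'; rewrite PP' eqxx in NPP'.
have l_uniq : uniq l by rewrite (perm_uniq lP) filter_uniq ?enum_uniq.
have sz (Q : pred 'I_n) : size [seq u <- enum 'I_n | Q u] = #|Q|.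
  by rewrite cardE enumT; congr size; apply: eq_filter.
have [|//|l' l'P' H] := relist l_uniq (m := [seq u <- enum 'I_n | P' u]).
- by rewrite filter_uniq ?enum_uniq.
- by rewrite (perm_size lP) !sz.
exists l' => // _ i /H[u lu uP']; exists u => //; apply/andP; split.
  have : u \in l by apply/onthP; exists i.
  by rewrite (perm_mem lP) mem_filter => /andP[].
by move: uP'; rewrite mem_filter mem_enum andbT.
Qed.

Section Rewiring.
Variables (n : nat) (G : digraph n).
Implicit Types (E : rel 'I_n) (B : {set 'I_n}).

Lemma rewire E : exists G' : digraph n, [/\ (G' : rel 'I_n) = E,
  forall v, indeg G v = indeg G' v ->
    (forall i, onth (in_list G v) i <> onth (in_list G' v) i ->
     exists2 u, onth (in_list G v) i = Some u & G u v && ~~ E u v) /\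
    (forall i, onth (nonin_list G v) i <> onth (nonin_list G' v) i ->
     exists2 u, onth (nonin_list G v) i = Some u & ~~ G u v && E u v) &
  forall v, outdeg G v = outdeg G' v ->
    (forall i, onth (out_list G v) i <> onth (out_list G' v) i ->
     exists2 u, onth (out_list G v) i = Some u & G v u && ~~ E v u) /\
    (forall i, onth (nonout_list G v) i <> onth (nonout_list G' v) i ->
     exists2 u, onth (nonout_list G v) i = Some u & ~~ G v u && E v u)].
Proof.
have list_choice (P P' : 'I_n -> pred 'I_n) (l : 'I_n -> seq 'I_n) :
    (forall v, perm_eq (l v) [seq u <- enum 'I_n | P v u]) ->
    exists l', forall v, perm_eq (l' v) [seq u <- enum 'I_n | P' v u] /\
      (#|P v| = #|P' v| -> forall i, onth (l v) i <> onth (l' v) i ->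
      exists2 u, onth (l v) i = Some u & P v u && ~~ P' v u).
  move=> lP; have lst v : exists l', perm_eq l' [seq u <- enum 'I_n | P' v u] /\
      (#|P v| = #|P' v| -> forall i, onth (l v) i <> onth l' i ->
      exists2 u, onth (l v) i = Some u & P v u && ~~ P' v u).
    by have [l' ? ?] := relist_pred (P' v) (lP v); exists l'.
  by have [l' Hl'] := boolp.choice lst; exists l'.
have [li Hli] := list_choice (fun v u => G u v) (fun v u => E u v) _ (in_listP G).
have [lo Hlo] := list_choice (fun v u => G v u) (fun v u => E v u) _ (out_listP G).
have [ni Hni] := list_choice (fun v u => ~~ G u v) (fun v u => ~~ E u v) _
  (nonin_listP G).
have [no Hno] := list_choice (fun v u => ~~ G v u) (fun v u => ~~ E v u) _
  (nonout_listP G).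
exists (Digraph (fun v => (Hli v).1) (fun v => (Hlo v).1)
  (fun v => (Hni v).1) (fun v => (Hno v).1)).
have cardN (P Q : pred 'I_n) : #|P| = #|Q| -> #|[pred u | ~~ P u]| = #|[pred u | ~~ Q u]|.
  by move=> PQ; have := cardC P; rewrite -(cardC Q) PQ => /addnI.
split=> // v deg; split=> i /=.
- exact: (Hli v).2.
- move=> /(Hni v).2 [|u ? /andP[? /negbNE ?]]; last by exists u => //; apply/andP.
  exact: (cardN (fun u => G u v) (fun u => E u v)).
- exact: (Hlo v).2.
- move=> /(Hno v).2 [|u ? /andP[? /negbNE ?]]; last by exists u => //; apply/andP.
  exact: (cardN (fun u => G v u) (fun u => E v u)).
Qed.

(** Vertices named by the query or by its reply on [G]; the modified graph does not enter, so one
    query can be tested against all modifications. A random vertex is not mentioned, since both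
    graphs return the same one. *)
Definition mentioned (q : query n) : seq 'I_n :=
  match q with
  | InDegree v | OutDegree v => [:: v]
  | InNeighbor v i => v :: seq_of_opt (onth (in_list G v) i)
  | OutNeighbor v i => v :: seq_of_opt (onth (out_list G v) i)
  | RandomVertex => [::]
  | Adjacent u v => [:: u; v]
  | NonInNeighbor v i => v :: seq_of_opt (onth (nonin_list G v) i)
  | NonOutNeighbor v i => v :: seq_of_opt (onth (nonout_list G v) i)
  end.

Lemma size_mentioned q : (size (mentioned q) <= 2)%N.
Proof. by case: q => //= v i; case: (onth _ _). Qed.

(** Detects a traded arc. Degrees are preserved by the trade, and arcs gained have an end in [B], so
    degree queries and lists of non-neighbours show nothing more. *)
Definition probed_arc (q : query n) : option ('I_n * 'I_n) :=
  match q with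
  | InNeighbor v i => omap (fun u => (u, v)) (onth (in_list G v) i)
  | OutNeighbor v i => omap (fun u => (v, u)) (onth (out_list G v) i)
  | Adjacent u v => Some (u, v)
  | _ => None
  end.

(** Without a trade the in-degree of [v] may change, and all queries on its in-side become
    suspicious. *)
Definition probed_head (q : query n) : option 'I_n :=
  match q with
  | InDegree v | InNeighbor v _ | NonInNeighbor v _ => Some v
  | _ => None
  end.

(** If the degree is unchanged, a changed list entry on [G] is an arc or non-arc that flipped;
    outside [B] the only flip is the loss of (y, v). The conclusion speaks of [G] alone, which the
    averaging over modifications requires. *)
Lemma reply_neq (G' : digraph n) B (keep : bool) (y v : 'I_n) x q :
  (forall w, indeg G w = indeg G' w ->
    (forall i, onth (in_list G w) i <> onth (in_list G' w) i ->
     exists2 u, onth (in_list G w) i = Some u & G u w && ~~ G' u w) /\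
    (forall i, onth (nonin_list G w) i <> onth (nonin_list G' w) i ->
     exists2 u, onth (nonin_list G w) i = Some u & ~~ G u w && G' u w)) ->
  (forall w, outdeg G w = outdeg G' w ->
    (forall i, onth (out_list G w) i <> onth (out_list G' w) i ->
     exists2 u, onth (out_list G w) i = Some u & G w u && ~~ G' w u) /\
    (forall i, onth (nonout_list G w) i <> onth (nonout_list G' w) i ->
     exists2 u, onth (nonout_list G w) i = Some u & ~~ G w u && G' w u)) ->
  (forall a b, a \notin B -> b \notin B -> G a b != G' a b ->
    [&& keep, a == y, b == v & G a b]) ->
  (forall b, b \notin B -> keep || (b != v) -> indeg G b = indeg G' b) ->
  (forall a, a \notin B -> outdeg G a = outdeg G' a) ->
  reply G x q <> reply G' x q ->
  has (mem B) (mentioned q) ||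
  (if keep then probed_arc q == Some (y, v) else probed_head q == Some v).
Proof.
move=> in_stable out_stable arc_stable indeg_stable outdeg_stable.
have head w : w \notin B -> (~~ keep && (w == v)) \/ indeg G w = indeg G' w.
  move=> wB; have [/indeg_stable|] := boolP (keep || (w != v)).
    by move=> H; right; apply: H.
  by rewrite negb_or negbK => ?; left.
case: q => [w|w|w i|w i||u w|w i|w i] //= neq.
- have [//|/head[/andP[/negPf -> /eqP ->]|E]] := boolP (w \in B).
    by rewrite eqxx.
  by rewrite E in neq.
- have [//|/outdeg_stable E] := boolP (w \in B).
  by rewrite E in neq.
- have [//|wB] := boolP (w \in B).
  have [/andP[/negPf -> /eqP ->]|/in_stable[H _]] := head _ wB.
    by rewrite eqxx orbT.
  have [|u -> /andP[Guw NGuw]] := H i; first by move=> E; apply: neq; rewrite E.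
  have [//=|uB] := boolP (u \in B); first by rewrite /= => ->.
  have := arc_stable u w uB wB; rewrite Guw (negPf NGuw) => /(_ isT).
  by case/and4P=> -> /eqP -> /eqP -> _; rewrite /= eqxx orbT.
- have [//|wB] := boolP (w \in B).
  have [H _] := out_stable w (outdeg_stable w wB).
  have [|u -> /andP[Guw NGuw]] := H i; first by move=> E; apply: neq; rewrite E.
  have [//=|uB] := boolP (u \in B); first by rewrite /= => ->.
  have := arc_stable w u wB uB; rewrite Guw (negPf NGuw) => /(_ isT).
  by case/and4P=> -> /eqP -> /eqP -> _; rewrite /= eqxx orbT.
- have [//|uB] := boolP (u \in B); have [//|wB] := boolP (w \in B).
  have [E|/(arc_stable u w uB wB)] := eqVneq (G u w) (G' u w).
    by rewrite E in neq.
  by case/and4P=> -> /eqP -> /eqP -> _; rewrite /= eqxx.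
- have [//|wB] := boolP (w \in B).
  have [/andP[/negPf -> /eqP ->]|/in_stable[_ H]] := head _ wB.
    by rewrite eqxx orbT.
  have [|u -> /andP[Guw NGuw]] := H i; first by move=> E; apply: neq; rewrite E.
  have [//=|uB] := boolP (u \in B); first by rewrite /= => ->.
  have := arc_stable u w uB wB; rewrite NGuw (negPf Guw) => /(_ isT).
  by rewrite !andbF.
- have [//|wB] := boolP (w \in B).
  have [_ H] := out_stable w (outdeg_stable w wB).
  have [|u -> /andP[Guw NGuw]] := H i; first by move=> E; apply: neq; rewrite E.
  have [//=|uB] := boolP (u \in B); first by rewrite /= => ->.
  have := arc_stable w u wB uB; rewrite NGuw (negPf Guw) => /(_ isT).
  by rewrite !andbF.
Qed.

End Rewiring.

(** * Random samples, one vertex per block *)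

Section Sampling.
Variables (n M m : nat) (Mm_le : (M * m <= n)%N).

Lemma slot_subproof (i : 'I_M) (j : 'I_m) : (i * m + j < n)%N.
Proof.
apply: leq_trans Mm_le; apply: (@leq_trans (i.+1 * m)).
  by rewrite mulSn addnC ltn_add2r.
by rewrite leq_mul2r ltn_ord orbT.
Qed.

Definition slot (i : 'I_M) (j : 'I_m) : 'I_n := Ordinal (slot_subproof i j).

Lemma slot_inj i j i' j' : slot i j = slot i' j' -> i = i' /\ j = j'.
Proof.
move=> /(congr1 val) /= E; have m_gt0 : (0 < m)%N by apply: leq_ltn_trans (ltn_ord j).
have Ei : i = i' :> nat.
  by have := congr1 (divn^~ m) E; rewrite !divnMDl // !divn_small // !addn0.
split; apply: val_inj => //=.
by move: E; rewrite Ei => /addnI.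
Qed.

Implicit Types sigma : {ffun 'I_M -> 'I_m}.

(** Disjoint blocks make the draws independent and at the same time distinct. *)
Definition draw sigma (i : 'I_M) : 'I_n := slot i (sigma i).

Lemma draw_inj sigma : injective (draw sigma).
Proof. by move=> i i' /slot_inj[]. Qed.

Definition sample sigma : {set 'I_n} := [set draw sigma i | i : 'I_M].

(** [b] lies in at most one block, where a uniform draw hits it with probability 1 / m. *)
Lemma card_samples_containing (b : 'I_n) :
  (#|[pred sigma | b \in sample sigma]| * m <= m ^ M)%N.
Proof.
have [/existsP[[i0 j0] /eqP/= b_slot]|noslot] :=
    boolP [exists p : 'I_M * 'I_m, slot p.1 p.2 == b]; last first.
  rewrite eq_card0 ?mul0n // => sigma; rewrite !inE; apply/negbTE.
  apply: contra noslot => /imsetP[i _ ->]; apply/existsP.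
  by exists (i, sigma i).
pose F (i : 'I_M) (j : 'I_m) : nat := if i == i0 then j == j0 else true.
rewrite (_ : #|_| = \sum_(sigma : {ffun 'I_M -> 'I_m}) \prod_i F i (sigma i))%N;
  last first.
  rewrite -sum1_card big_mkcond /=; apply: eq_bigr => sigma _; rewrite inE.
  rewrite (bigD1 i0) //= big1 ?muln1 => [|i /negPf ni]; last by rewrite /F ni.
  rewrite /F eqxx; congr (if _ then _ else _).
  rewrite -b_slot; apply/imsetP/eqP => [[i _ /slot_inj[-> ->//]]|<-].
  by exists i0.
rewrite -bigA_distr_bigA (bigD1 i0) //=.
rewrite (_ : \sum_j F i0 j = 1)%N; last first.
  rewrite (bigD1 j0) //= /F !eqxx big1 // => j /negPf jj0.
  by rewrite jj0.
rewrite mul1n (eq_bigr (fun=> m)) => [|i /negPf ni]; last first.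
  rewrite /F ni sum1_card card_ord //.
rewrite prod_nat_const cardC1 card_ord -expnSr prednK //.
by apply: leq_trans (ltn_ord i0).
Qed.

Lemma card_slots (W : {set 'I_n}) :
  (#|W| <= \sum_i \sum_j (slot i j \in W) + (n - M * m))%N.
Proof.
pose f (p : 'I_M * 'I_m) := slot p.1 p.2.
have f_inj : injective f by move=> [i j] [i' j'] /slot_inj[/= -> ->].
pose C := f @: [set: 'I_M * 'I_m]%SET.
have cardC : #|C| = (M * m)%N.
  by rewrite card_imset // cardsT card_prod !card_ord.
rewrite -(cardsID C W) leq_add //.
  rewrite pair_bigA /=.
  rewrite (_ : \sum_p _ = #|f @: [set p | f p \in W]%SET|)%N.
    apply: subset_leq_card; apply/fintype.subsetP => v; rewrite !inE => /andP[vW].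
    by move=> /imsetP[p _ vp]; rewrite vp imset_f // inE -vp.
  rewrite card_imset // -sum1_card [RHS]big_mkcond /=; apply: eq_bigr => p _.
  by rewrite inE; case: (_ \in _).
rewrite -cardC -[X in (_ <= X - _)%N]card_ord -[X in (_ <= X - _)%N](cardsC C).
by rewrite addKn subset_leq_card // finset.setDE finset.subsetIr.
Qed.

Lemma card_sample_setI sigma (W : {set 'I_n}) :
  #|sample sigma :&: W| = (\sum_i (draw sigma i \in W))%N.
Proof.
rewrite (_ : sample sigma :&: W = draw sigma @: [set i | draw sigma i \in W]%SET).
  rewrite card_imset; last exact: draw_inj.
  rewrite -sum1_card big_mkcond /=; apply: eq_bigr => i _.
  by rewrite inE; case: (_ \in _).
apply/setP => v; rewrite inE; apply/andP/imsetP.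
  by case=> /imsetP[i _ ->] iW; exists i => //; rewrite inE.
by case=> i; rewrite inE => iW ->; rewrite imset_f.
Qed.

(* Chernoff bound, through the moment generating function at -ln 2. *)
Lemma card_samples_few (R : realType) (W : {set 'I_n}) (k : nat) :
  (0 < m)%N ->
  (#|[pred sigma | (#|sample sigma :&: W| < k)%N]|%:R : R) <=
  (m ^ M)%:R * 2 ^+ k *
  expR (- ((\sum_i \sum_j (slot i j \in W))%N%:R / (2 * m%:R))).
Proof.
move=> m_gt0; have mR_gt0 : 0 < m%:R :> R by rewrite ltr0n.
pose F (i : 'I_M) (j : 'I_m) : R := if slot i j \in W then 2^-1 else 1.
apply: (@le_trans _ _ (2 ^+ k *
    \sum_(sigma : {ffun 'I_M -> 'I_m}) \prod_i F i (sigma i))).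
  rewrite -sum1_card natr_sum big_mkcond mulr_sumr /=.
  apply: ler_sum => sigma _; rewrite inE card_sample_setI.
  rewrite (_ : \prod_i F i (sigma i) =
      2^-1 ^+ (\sum_i (draw sigma i \in W))); last first.
    rewrite expr_sum; apply: eq_bigr => i _; rewrite /F /draw.
    by case: ifP => _; rewrite ?expr1 ?expr0.
  case: ifP => [ltk|_]; last by rewrite mulr_ge0 ?exprn_ge0 // invr_ge0.
  rewrite exprVn -(subnK (ltnW ltk)) exprD -mulrA divff ?expf_neq0 //.
  by rewrite mulr1 exprn_ege1 // ler1n.
rewrite -bigA_distr_bigA -[leRHS]mulrA [leRHS]mulrCA ler_wpM2l ?exprn_ge0 //.
(* A block with density p of [W] averages 2^(-indicator) to 1 - p / 2, and 1 + x <= exp x turns the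
   product into the exponential of a sum. *)
apply: (@le_trans _ _ (\prod_(i < M)
    (m%:R * expR (- ((\sum_j (slot i j \in W))%N%:R / (2 * m%:R)))))).
  apply: ler_prod => i _; apply/andP; split.
    by apply: sumr_ge0 => j _; rewrite /F; case: ifP; rewrite ?invr_ge0.
  rewrite (_ : \sum_j F i j = m%:R * (1 +
      - ((\sum_j (slot i j \in W))%N%:R / (2 * m%:R)))); last first.
    set x := (X in X / _); rewrite (_ : m%:R * _ = m%:R - x / 2); last first.
      by field; rewrite lt0r_neq0.
    rewrite /x natr_sum mulr_suml -[X in X%:R - _](card_ord m) -sumr_const.
    rewrite -sumrB; apply: eq_bigr => j _.
    by rewrite /F; case: ifP => _; rewrite ?mul1r ?mul0r; lra.
  by rewrite ler_wpM2l // expR_ge1Dx.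
rewrite big_split /= prodr_const card_ord natrX ler_wpM2l ?exprn_ge0 //.
by rewrite -expR_sum sumrN -mulr_suml -natr_sum.
Qed.

End Sampling.

(** * Runs of an algorithm *)

(** Events that quantify over the next query become countable unions, hence measurable. *)
Lemma countable_query (n : nat) : countable [set: query n].
Proof.
pose code (q : query n) : option (option (nat * ('I_n * nat)) * 'I_n) + nat * 'I_n :=
  match q with
  | InDegree v => inr (0%N, v) | OutDegree v => inr (1%N, v)
  | InNeighbor v i => inl (Some (Some (0%N, (v, i)), v))
  | OutNeighbor v i => inl (Some (Some (1%N, (v, i)), v))
  | RandomVertex => inl None
  | Adjacent u v => inl (Some (Some (2%N, (u, 0%N)), v))
  | NonInNeighbor v i => inl (Some (Some (3%N, (v, i)), v))
  | NonOutNeighbor v i => inl (Some (Some (4%N, (v, i)), v))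
  end.
apply/countable_injP; exists (pickle \o code) => q1 q2 _ _.
move=> /(pcan_inj pickleK).
case: q1 => [v|v|v i|v i||u v|v i|v i]; case: q2 => [v'|v'|v' i'|v' i'||u' v'|v' i'|v' i'] //=;
  by move=> H; inversion H; subst.
Qed.

Section Runs.
Variables (R : realType) (n : nat) (A : algorithm R n).

Definition run_hist (G : digraph n) (w : seed A) (j : nat) : seq (answer n) :=
  transcript (strategy (coins w)) G (fun j => rand_vertex j w) j.

Lemma measurable_coins (B : set (coin_space A)) :
  measurable B -> measurable [set w : seed A | B (coins w)].
Proof.
move=> mB; have := coins_meas (a := A) measurableT mB.
by rewrite setTI.
Qed.

Lemma measurable_ask hist q :
  measurable [set w : seed A | strategy (coins w) hist = Ask q].
Proof. exact: (measurable_coins (strategy_ask_meas A hist q)). Qed.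

Lemma measurable_output hist (B : set R) : measurable B ->
  measurable [set w : seed A |
    exists2 y, B y & strategy (coins w) hist = Output y].
Proof. by move=> mB; exact: (measurable_coins (strategy_output_meas A hist mB)). Qed.

Lemma measurable_ask_with hist (P : query n -> set (seed A)) :
  (forall q, measurable (P q)) ->
  measurable [set w | exists2 q, strategy (coins w) hist = Ask q & P q w].
Proof.
move=> mP; rewrite (_ : [set _ | _] = \bigcup_q
    ([set w | strategy (coins w) hist = Ask q] `&` P q)).
  apply: countable_bigcupT_measurable; first exact: countable_query.
  by move=> q; apply: measurableI => //; exact: measurable_ask.
apply/seteqP; split => w /=; first by case=> q; exists q.
by case=> q _ [? ?]; exists q.
Qed.

Lemma measurable_rand_vertex j (P : 'I_n -> set (seed A)) :
  (forall v, measurable (P v)) ->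
  measurable [set w | P (rand_vertex j w) w].
Proof.
move=> mP; rewrite (_ : [set _ | _] = \bigcup_v
    ([set w | rand_vertex j w = v] `&` P v)).
  apply: countable_bigcupT_measurable; first exact: countableP.
  by move=> q; apply: measurableI => //; exact: rand_vertex_meas.
apply/seteqP; split => w /=; first by move=> ?; exists (rand_vertex j w).
by case=> q _ [-> ?].
Qed.

Lemma measurable_const (Q : Prop) : measurable [set w : seed A | Q].
Proof.
have [q|nq] := pselect Q.
  by rewrite (_ : [set _ | _] = setT) //; apply/seteqP; split.
by rewrite (_ : [set _ | _] = set0) //; apply/seteqP; split.
Qed.

(** The induction runs over all families [P], which may depend on the seed: the last step of the run
    is folded into a new family for the shorter history. *)
Lemma measurable_transcript G j (P : seq (answer n) -> set (seed A)) :
  (forall hist, measurable (P hist)) ->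
  measurable [set w | P (run_hist G w j) w].
Proof.
elim: j P => [|j IHj] P mP; first exact: mP.
rewrite (_ : [set _ | _] = [set w |
    (exists2 q, strategy (coins w) (run_hist G w j) = Ask q &
       P (rcons (run_hist G w j) (reply G (rand_vertex j w) q)) w)
    \/ ((exists2 y, setT y & strategy (coins w) (run_hist G w j) = Output y)
       /\ P (run_hist G w j) w)]).
  apply: (IHj (fun hist => [set w |
    (exists2 q, strategy (coins w) hist = Ask q &
       P (rcons hist (reply G (rand_vertex j w) q)) w)
    \/ ((exists2 y, setT y & strategy (coins w) hist = Output y)
       /\ P hist w)])) => hist.
  apply: measurableU; last first.
    by apply: measurableI => //; apply: measurable_output.
  apply: (@measurable_ask_with hist
    (fun q => [set w | P (rcons hist (reply G (rand_vertex j w) q)) w])) => q.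
  exact: (@measurable_rand_vertex j
    (fun x => [set w | P (rcons hist (reply G x q)) w]) (fun x => mP _)).
apply/seteqP; split => w /=; rewrite /run_hist /=.
  case E: (strategy (coins w) _) => [q|y] Pw; first by left; exists q.
  by right; split=> //; exists y.
by case=> [[q ->]|[[y _ ->]]].
Qed.

(** Equality of two real outputs is no countable union, but its failure is: distinct outputs are
    separated by a rational. *)
Lemma measurable_same_output hist1 hist2 :
  measurable [set w : seed A | exists y,
    strategy (coins w) hist1 = Output y /\ strategy (coins w) hist2 = Output y].
Proof.
pose out hist (B : set R) := [set w : seed A |
    exists2 y, B y & strategy (coins w) hist = Output y].
pose sep h1 h2 (q : rat) := out h1 [set` `]-oo, (ratr q)[%R]
  `&` out h2 [set` `[(ratr q), +oo[%R].
have msep h1 h2 q : measurable (sep h1 h2 q).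
  by apply: measurableI; apply: measurable_output; apply: measurable_itv.
rewrite (_ : [set _ | _] = (out hist1 setT `&` out hist2 setT) `\`
    (\bigcup_q (sep hist1 hist2 q `|` sep hist2 hist1 q))).
  apply: measurableD.
    by apply: measurableI; apply: measurable_output.
  apply: countable_bigcupT_measurable => [|q]; first exact: countableP.
  exact: measurableU.
have lt_sep h1 h2 (w : seed A) y1 y2 : y1 < y2 ->
    strategy (coins w) h1 = Output y1 -> strategy (coins w) h2 = Output y2 ->
    exists q, sep h1 h2 q w.
  move=> y12 E1 E2; have [q] := rat_in_itvoo y12.
  rewrite in_itv /= => /andP[y1q qy2]; exists q; split.
    by exists y1 => //=; rewrite in_itv.
  by exists y2 => //=; rewrite in_itv /= andbT ltW.
have sep_neq h1 h2 (w : seed A) y q : strategy (coins w) h1 = Output y ->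
    strategy (coins w) h2 = Output y -> ~ sep h1 h2 q w.
  move=> E1 E2 [[y1 /= y1q]]; rewrite E1 => -[yy1] [y2 /= y2q].
  rewrite E2 => -[yy2]; move: y1q y2q; rewrite -yy1 -yy2 !in_itv /= andbT.
  by move=> /lt_le_trans H /H; rewrite ltxx.
apply/seteqP; split => w /=.
  move=> [y [E1 E2]]; split; first by split; exists y.
  by case=> q _ [|]; apply: sep_neq; eassumption.
move=> [[[y1 _ E1] [y2 _ E2]] nsep].
have [lt12|lt21|E12] := ltgtP y1 y2.
- by case: nsep; have [q ?] := lt_sep _ _ _ _ _ lt12 E1 E2; exists q => //; left.
- by case: nsep; have [q ?] := lt_sep _ _ _ _ _ lt21 E2 E1; exists q => //; right.
- by exists y1; split=> //; rewrite E12.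
Qed.

Lemma measurable_same_output_event G H : measurable
  [set w : seed A | exists y, seed_outputs G w y /\ seed_outputs H w y].
Proof.
rewrite (_ : [set _ | _] = \bigcup_i \bigcup_j [set w | exists y,
    strategy (coins w) (run_hist G w i) = Output y /\
    strategy (coins w) (run_hist H w j) = Output y]).
  apply: bigcupT_measurable => i; apply: bigcupT_measurable => j.
  apply: (@measurable_transcript G i (fun h1 => [set w | exists y,
    strategy (coins w) h1 = Output y /\
    strategy (coins w) (run_hist H w j) = Output y])) => h1.
  apply: (@measurable_transcript H j (fun h2 => [set w | exists y,
    strategy (coins w) h1 = Output y /\
    strategy (coins w) h2 = Output y])) => h2.
  exact: measurable_same_output.
apply/seteqP; split => w /=.
  by case=> y [[i Hi] [j Hj]]; exists i => //; exists j => //; exists y.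
by case=> i _ [j _ [y [Hi Hj]]]; exists y; split; [exists i|exists j].
Qed.

Definition asking (G : digraph n) (j : nat) : set (seed A) :=
  [set w | asks (strategy (coins w)) G (fun j => rand_vertex j w) j].

Lemma measurable_asking G j : measurable (asking G j).
Proof.
rewrite (_ : asking G j = [set w |
    exists2 q, strategy (coins w) (run_hist G w j) = Ask q & setT w]).
  apply: (@measurable_transcript G j (fun hist => [set w |
    exists2 q, strategy (coins w) hist = Ask q & setT w])) => hist.
  exact: (@measurable_ask_with hist (fun=> setT)).
apply/seteqP; split => w; rewrite /asking /asks /run_hist /=.
  by case: (strategy (coins w) _) => // q _; exists q.
by case=> q ->.
Qed.

Lemma indic_asking G j (w : seed A) : \1_(asking G j) w =
  (asks (strategy (coins w)) G (fun j => rand_vertex j w) j)%:R :> R.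
Proof. by rewrite indicE; congr (nat_of_bool _)%:R; apply/idP/idP; rewrite inE. Qed.

(** Both replies are taken at the history of the run on [G], so that this run alone governs all
    choices of [H]. *)
Definition detecting (G H : digraph n) (j : nat) : set (seed A) :=
  [set w | exists2 q, strategy (coins w) (run_hist G w j) = Ask q &
     reply G (rand_vertex j w) q <> reply H (rand_vertex j w) q].

Lemma measurable_detecting G H j : measurable (detecting G H j).
Proof.
apply: (@measurable_transcript G j (fun hist => [set w |
    exists2 q, strategy (coins w) hist = Ask q &
     reply G (rand_vertex j w) q <> reply H (rand_vertex j w) q])) => hist.
apply: (@measurable_ask_with hist (fun q => [set w |
     reply G (rand_vertex j w) q <> reply H (rand_vertex j w) q])) => q.
exact: (@measurable_rand_vertex j (fun x => [set w |
     reply G x q <> reply H x q]) (fun x => measurable_const _)).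
Qed.

Lemma same_run G H (w : seed A) :
  (forall j, ~ detecting G H j w) -> forall j, run_hist H w j = run_hist G w j.
Proof.
move=> ND; elim=> [//|j IHj]; rewrite /run_hist /= -/(run_hist H w j).
rewrite -/(run_hist G w j) IHj; case E: (strategy (coins w) _) => [q|//].
congr (rcons _ _); apply: contrapT => NE; apply: (ND j).
by exists q => // /esym.
Qed.

(** Without detection the runs coincide, but a common output exists only if they halt; the last
    event accounts for runs that do not. *)
Lemma same_output_cover G H : setT `<=`
  [set w : seed A | exists y, seed_outputs H w y /\ seed_outputs G w y] `|`
  (\bigcup_j detecting G H j `|` \bigcap_j asking G j).
Proof.
move=> w _; have [D|ND] := pselect ((\bigcup_j detecting G H j) w).
  by right; left.
have [N|] := pselect ((\bigcap_j asking G j) w); first by right; right.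
move=> /existsNP[j /not_implyP[_ NA]]; left.
have run j' : run_hist H w j' = run_hist G w j'.
  by apply: same_run => i Di; apply: ND; exists i.
move: NA; rewrite /asking /asks /= -/(run_hist G w j).
case E: (strategy (coins w) _) => [q|y] // _; exists y.
by split; exists j; rewrite -/(run_hist _ w j) ?run.
Qed.

Local Open Scope ereal_scope.

(** Exchanging integral and sum lets detection be charged step by step; the leading 1 shows that
    every time bound is at least 1. *)
Lemma expected_time_asking (G : digraph n) :
  expected_time A G = 1 + \sum_(0 <= j <oo) seed_law A (asking G j).
Proof.
pose a j (w : seed A) : \bar R :=
  (asks (strategy (coins w)) G (fun j => rand_vertex j w) j)%:R%:E.
have mask j : measurable_fun setT (a j).
  rewrite (_ : a j = (fun w => (\1_(asking G j) w)%:E)).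
    by apply/measurable_EFinP; apply: measurable_indic; apply: measurable_asking.
  by apply/funext => w; rewrite indic_asking.
rewrite /expected_time /run_time ge0_integralD //=; last 2 first.
- by move=> w _; apply: nneseries_ge0 => j _ _; rewrite lee_fin.
- apply: ge0_emeasurable_sum; first by move=> j w _ _; rewrite lee_fin.
  by move=> j _; apply: mask.
rewrite (integral_cst (seed_law A)) // mul1e [X in X + _](@probability_setT _ _ _ (seed_law A)).
congr (_ + _).
rewrite (@integral_nneseries _ _ _ _ _ _ a) //; last first.
  by move=> j w _; rewrite lee_fin.
apply: eq_eseriesr => j _.
rewrite -[RHS](_ : seed_law A (asking G j `&` setT) = _); last by rewrite setIT.
rewrite -integral_indic //; last exact: measurable_asking.
by apply: eq_integral => w _; rewrite indic_asking.
Qed.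

(** The event lies in every [asking G j], so J times its probability is at most [E] for each J. *)
Lemma never_halting0 G (E : R) : expected_time A G <= E%:E ->
  seed_law A (\bigcap_j asking G j) = 0.
Proof.
rewrite expected_time_asking => timeE; set N := \bigcap_j _.
have mN : measurable N by apply: bigcapT_measurable => j; apply: measurable_asking.
have Nge0 : 0 <= seed_law A N by [].
have Nfin : seed_law A N \is a fin_num by rewrite fin_num_measure.
have bound J : (J%:R * fine (seed_law A N) <= E)%R.
  rewrite -lee_fin EFinM fineK //; apply: le_trans timeE.
  rewrite -[leLHS]add0e; apply: leeD => //.
  apply: le_trans (nneseries_lim_ge J _) => //.
  rewrite big_mkord -[X in X%:E * _](_ : (\sum_(j < J) 1)%R = _); last first.
    by rewrite sumr_const card_ord.
  rewrite -sumEFin ge0_sume_distrl //; apply: lee_sum => j _.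
  rewrite mul1e; apply: le_measure; rewrite ?inE //.
    exact: measurable_asking.
  exact: bigcap_inf.
rewrite -(fineK Nfin); congr (_%:E); apply/eqP; rewrite eq_le fine_ge0 // andbT.
rewrite leNgt; apply/negP => Npos.
have := bound (Num.trunc (E / fine (seed_law A N))).+1.
by rewrite leNgt -ltr_pdivrMr // Num.Theory.truncnS_gt.
Qed.

(* Only the run on G is averaged over: as long as no reply has differed, the
   run on the modified graph makes the same queries. *)
Lemma average_detection (G : digraph n) (I : finType) (H : I -> digraph n)
    (p E : R) :
  (0 <= p)%R -> expected_time A G <= E%:E ->
  (forall x q, (#|[pred c | `[< reply G x q <> reply (H c) x q >]]|%:R <= p)%R) ->
  exists e : I -> R, [/\ forall c, (0 <= e c)%R,
    forall c, (1 - e c)%:E <= same_output_prob A (H c) G &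
    (\sum_c e c <= p * E)%R].
Proof.
move=> p0 timeE Hp.
pose D c := \bigcup_j detecting G (H c) j.
have mD c : measurable (D c).
  by apply: bigcupT_measurable => j; apply: measurable_detecting.
have finD c : seed_law A (D c) \is a fin_num by rewrite fin_num_measure.
exists (fun c => fine (seed_law A (D c))); split.
- by move=> c; apply: fine_ge0.
- move=> c; rewrite EFinB fineK // leeBlDr //.
  rewrite -(@probability_setT _ _ _ (seed_law A)).
  have mS := measurable_same_output_event (H c) G.
  have mN : measurable (\bigcap_j asking G j).
    by apply: bigcapT_measurable => j; apply: measurable_asking.
  apply: (@le_trans _ _ (seed_law A (
    [set w | exists y, seed_outputs (H c) w y /\ seed_outputs G w y] `|`
    (D c `|` \bigcap_j asking G j)))).
    apply: le_measure; rewrite ?inE //.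
      by apply: measurableU => //; apply: measurableU.
    exact: same_output_cover.
  apply: le_trans (measureU2 _ _ _) _ => //; first exact: measurableU.
  rewrite /same_output_prob leeD2l //.
  apply: le_trans (measureU2 _ _ _) _ => //.
  by rewrite [X in _ + X](never_halting0 timeE) adde0.
(* For a fixed seed the j-th query on [G] is the same for all c, so at most p of them detect at step
   j, and none if no query is made. *)
have step j : \sum_c seed_law A (detecting G (H c) j) <=
    p%:E * seed_law A (asking G j).
  pose f c (w : seed A) : \bar R := (\1_(detecting G (H c) j) w)%:E.
  have mf c : measurable_fun setT (f c).
    by apply/measurable_EFinP; apply: measurable_indic; apply: measurable_detecting.
  have mI : measurable_fun setT (fun w => (\1_(asking G j) w)%:E : \bar R).
    by apply/measurable_EFinP; apply: measurable_indic; apply: measurable_asking.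
  rewrite -[X in _ <= _ * seed_law A X]setIT -integral_indic //; last first.
    exact: measurable_asking.
  have I0 (w : seed A) : setT w -> 0 <= (\1_(asking G j) w)%:E :> \bar R.
    by rewrite lee_fin.
  rewrite -(ge0_integralZl_EFin (seed_law A) measurableT I0 mI p0).
  rewrite (eq_bigr (fun c => \int[seed_law A]_w f c w)); last first.
    move=> c _; rewrite integral_indic ?setIT //; exact: measurable_detecting.
  have f0 c w : setT w -> 0 <= f c w by rewrite lee_fin.
  rewrite -(ge0_integral_sum (seed_law A) measurableT mf f0).
  apply: ge0_le_integral => //.
  - by move=> w _; apply: sume_ge0 => c _; rewrite lee_fin.
  - exact: emeasurable_sum.
  - by apply: emeasurable_funM => //; exact: measurable_cst.
  move=> w _; rewrite sumEFin -EFinM lee_fin.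
  have [Aw|NAw] := pselect (asking G j w); last first.
    rewrite big1 ?mulr_ge0 // => c _; rewrite indicE memNset // => -[q Eq _].
    by apply: NAw; rewrite /asking /asks /= -/(run_hist G w j) Eq.
  rewrite indicE mem_set // mulr1.
  move: Aw; rewrite /asking /asks /= -/(run_hist G w j).
  case Eq: (strategy (coins w) _) => [q|//] _.
  apply: le_trans (Hp (rand_vertex j w) q).
  rewrite -sum1_card natr_sum [leRHS]big_mkcond; apply: ler_sum => c _.
  rewrite indicE inE; case: asboolP => [_|ND]; first by rewrite lern1 leq_b1.
  by rewrite memNset //= => -[q']; rewrite Eq => -[<-].
rewrite -lee_fin -sumEFin (eq_bigr (fun c => seed_law A (D c))); last first.
  by move=> c _; rewrite fineK.
apply: (@le_trans _ _ (\sum_c \sum_(0 <= j <oo) seed_law A (detecting G (H c) j))).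
  apply: lee_sum => c _; apply: measure_sigma_subadditive => // j.
  exact: measurable_detecting.
rewrite -nneseries_sum //.
apply: (@le_trans _ _ (\sum_(0 <= j <oo) (p%:E * seed_law A (asking G j)))).
  by apply: lee_nneseries => // j _ _; apply: sume_ge0.
rewrite nneseriesZl // EFinM; apply: lee_wpmul2l; first by rewrite lee_fin.
apply: le_trans timeE; rewrite expected_time_asking -[leLHS]add0e.
by apply: leeD.
Qed.

End Runs.

(** * The gadget *)

Section Gadget.
Variables (n : nat) (G : digraph n) (H S0 S' : {set 'I_n}) (x v : 'I_n).
Variables (keep : bool) (y z : 'I_n).

Let S : {set 'I_n} := x |: S0.
Let B : {set 'I_n} := S :|: S'.

(* S0 is pointed to x and x to v; arcs into the set H of vertices of high
   in-degree survive, because S' could not absorb them. *)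
Definition pruned (a b : 'I_n) : bool :=
  (b == if a == x then v else x) || (b \in H) && G a b.

Definition removed (b : 'I_n) : {set 'I_n} :=
  [set a in S | G a b && ~~ pruned a b]%SET.

Definition absorb (b : 'I_n) : {set 'I_n} :=
  [set a in take #|removed b| (enum [set a in S' | ~~ G a b]%SET)]%SET.

(** The trade at [y] takes place only if (x, v) is a new arc; otherwise [v] gains nothing that has
    to be hidden. *)
Definition rewired (a b : 'I_n) : bool :=
  if a \in S then pruned a b
  else if a \in S' then G a b || (a \in absorb b)
  else if [&& keep, a == y & ~~ G x v] then G a b && (b != v) || (b == z)
  else G a b.

Hypothesis SS' : forall a, a \in S -> a \notin S'.
Hypothesis vB : v \notin B.
Hypothesis keepP : keep -> [/\ G y v, y \notin B, z \in B & ~~ G y z].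
Hypothesis spare : forall b, b \notin H ->
  (#|S| <= #|[set a in S' | ~~ G a b]%SET|)%N.

Lemma absorb_sub a b : a \in absorb b -> (a \in S') && ~~ G a b.
Proof. by rewrite inE => /mem_take; rewrite mem_enum inE. Qed.

(** [pruned] removes nothing into [H]; for other heads [spare] provides enough candidates. *)
Lemma card_absorb b : #|absorb b| = #|removed b|.
Proof.
have [bH|bH] := boolP (b \in H).
  have r0 : removed b = finset.set0.
    apply/setP => a; rewrite !inE /pruned bH; case: (G a b); rewrite ?andbF //.
    by rewrite !orbT !andbF.
  rewrite r0 cards0 eq_card0 // => a; rewrite /absorb r0 cards0 take0.
  by rewrite !inE.
rewrite /absorb cardsE (card_uniqP _) ?take_uniq ?enum_uniq //.
rewrite size_takel // -cardE; apply: leq_trans (spare bH).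
by apply: subset_leq_card; apply/fintype.subsetP => a; rewrite inE => /andP[].
Qed.

Lemma rewired_outside a b : a \notin B -> b \notin B -> G a b != rewired a b ->
  [&& keep, a == y, b == v & G a b].
Proof.
rewrite /rewired !inE !negb_or => /andP[/andP[/negPf -> /negPf ->] /negPf ->] /=.
move=> bB; case: ifP => [/and3P[kT ay _]|]; last by rewrite eqxx.
have [_ _ zB _] := keepP kT.
have /negPf -> : b != z.
  by apply: contraTneq zB => <-; rewrite !inE !negb_or.
by rewrite kT ay orbF; case: (G a b) (b == v) => -[].
Qed.

(** Only the tail has to lie outside [B]: the comparison of walks needs whole rows. *)
Lemma rewired_del a b : a \notin B -> G a b -> ~~ rewired a b ->
  [&& keep, a == y & b == v].
Proof.
rewrite /rewired !inE !negb_or => /andP[/andP[/negPf -> /negPf ->] /negPf ->] /=.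
move=> Gab; case: ifP => [/and3P[kT ay _]|]; last by rewrite Gab.
by rewrite Gab /= kT ay negb_or negbK => /andP[].
Qed.

Lemma rewired_indeg b : b \notin B -> keep || (b != v) ->
  #|[pred a | G a b]| = #|[pred a | rewired a b]|.
Proof.
move=> bB kb; pose inG := [set a | G a b]%SET; pose inE' := [set a | rewired a b]%SET.
rewrite -(cardsE [pred a | G a b]) -(cardsE [pred a | rewired a b]).
(* Common in-neighbours cancel, so the lost ones are matched with the gained ones. *)
rewrite -[LHS](cardsID inE' inG) -[RHS](cardsID inG inE') finset.setIC.
congr (_ + _)%N.
have mG a : (a \in inG) = G a b by rewrite inE.
have mE a : (a \in inE') = rewired a b by rewrite inE.
have mR a : (a \in removed b) = [&& a \in S, G a b & ~~ pruned a b].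
  by rewrite /removed inE.
have bx : (b == x) = false.
  by apply: contraNF bB => /eqP ->; rewrite !inE eqxx.
have vx : (x == v) = false.
  by apply: contraNF vB => /eqP <-; rewrite !inE eqxx.
have SnS' a : a \in S -> (a \in S') = false.
  by move=> aS; apply/negbTE/SS'.
have xS : x \in S by rewrite !inE eqxx.
have xabs : x \notin absorb b.
  by apply/negP => /absorb_sub; rewrite SnS'.
have abs_notS a : a \in absorb b -> a \notin S.
  by move=> /absorb_sub/andP[aS' _]; apply/negP => /SnS'; rewrite aS'.
have prunedE a : a \in S -> ~~ G a b ->
    pruned a b = (a == x) && (b == v).
  by move=> aS /negPf NG; rewrite /pruned NG andbF orbF; case: ifP; rewrite ?bx.
(* Only here is there a change beyond [removed] and [absorb]: [x] is gained and [y] is lost. *)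
have [/andP[/eqP bv NGxv]|ND] := boolP ((b == v) && ~~ G x v).
  have kT : keep by move: kb; rewrite bv eqxx orbF.
  have [Gyv yB zB NGyz] := keepP kT.
  have bz : (b == z) = false.
    by apply: contraNF bB => /eqP ->.
  have yS : (y \in S) = false by apply: contraNF yB => yS; rewrite inE yS.
  have yS' : (y \in S') = false by apply: contraNF yB => yS'; rewrite inE yS' orbT.
  have -> : inG :\: inE' = y |: removed b.
    apply/setP => a; rewrite finset.in_setD finset.in_setU1 mG mE mR /rewired.
    have [->|ay] := eqVneq a y.
      by rewrite yS yS' kT NGxv /= bz bv eqxx andbF Gyv.
    rewrite andbF /=; case: ifP => [_|aS]; first by rewrite andbC.
    by case: ifP => _; case: (G a b); rewrite ?andbF.
  have -> : inE' :\: inG = x |: absorb b.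
    apply/setP => a; rewrite finset.in_setD finset.in_setU1 mG mE /rewired.
    have [aS|aS] := boolP (a \in S).
      have [Gab|NGab] := boolP (G a b).
        rewrite /=; apply/esym/norP; split.
          by apply: contraTneq Gab => ->; rewrite bv.
        by apply: contraTN aS => /abs_notS.
      rewrite prunedE // (introT eqP bv) andbT /=.
      rewrite (_ : (a \in absorb b) = false) ?orbF //.
      by apply: contraTF aS => /abs_notS.
    have -> : (a == x) = false by apply: contraNF aS => /eqP ->.
    case: ifP => aS' /=.
      have [Gab|NGab] /= := boolP (G a b); last by [].
      by apply/esym/negbTE/negP => /absorb_sub; rewrite Gab andbF.
    have -> : (a \in absorb b) = false.
      by apply/negP => /absorb_sub; rewrite aS'.
    by case: ifP => _; rewrite ?bz ?orbF; case: (G a b).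
  by rewrite !cardsU1 card_absorb xabs mR yS.
have -> : inG :\: inE' = removed b.
  apply/setP => a; rewrite finset.in_setD mG mE mR /rewired.
  have [aS|aS] := boolP (a \in S); first by rewrite andbC.
  case: ifP => aS' /=; first by case: (G a b); rewrite ?andbF.
  case: ifP => [/and3P[kT ay NGxv]|_]; last by case: (G a b); rewrite ?andbF.
  by move: ND; rewrite NGxv andbT => ->; case: (G a b); rewrite ?andbF.
have -> : inE' :\: inG = absorb b.
  apply/setP => a; rewrite finset.in_setD mG mE /rewired.
  have [aS|aS] := boolP (a \in S).
    rewrite [RHS](_ : _ = false); last by apply: contraTF aS => /abs_notS.
    have [//|NGab] /= := boolP (G a b).
    rewrite prunedE //; apply: contraNF ND => /andP[/eqP ax bv].
    by rewrite bv -ax; move: NGab; rewrite (eqP bv).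
  case: ifP => aS' /=.
    have [Gab|NGab] /= := boolP (G a b); last by [].
    by apply/esym/negbTE/negP => /absorb_sub; rewrite Gab andbF.
  rewrite [RHS](_ : _ = false); last by apply/negP => /absorb_sub; rewrite aS'.
  case: ifP => [/and3P[kT ay NGxv]|_]; last by case: (G a b); rewrite ?andbF.
  have [_ _ zB _] := keepP kT.
  have -> : (b == z) = false by apply: contraNF bB => /eqP ->.
  by rewrite orbF; case: (G a b).
by rewrite card_absorb.
Qed.

(** Only [y] swaps an out-neighbour, [v] for [z]; [~~ G y z] makes the gain a real one. *)
Lemma rewired_outdeg a : a \notin B ->
  #|[pred b | G a b]| = #|[pred b | rewired a b]|.
Proof.
rewrite !inE !negb_or => /andP[/andP[/negPf ax /negPf aS0] /negPf aS'].
have aS : (a \in S) = false by rewrite !inE ax aS0.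
have [/and3P[kT /eqP ay NGxv]|C] := boolP [&& keep, a == y & ~~ G x v]; last first.
  by apply: eq_card => b; rewrite !inE /rewired aS aS' (negPf C).
have [Gyv yB zB NGyz] := keepP kT.
rewrite -(cardsE [pred b | G a b]) -(cardsE [pred b | rewired a b]).
set outG := [set b in [pred b | G a b]]%SET.
have mG b : (b \in outG) = G a b by rewrite !inE.
rewrite (_ : [set b in [pred b | rewired a b]]%SET = z |: (outG :\ v)).
  rewrite cardsU1 finset.in_setD1 mG ay (negPf NGyz) andbF.
  by rewrite (cardsD1 v outG) mG ay Gyv.
apply/setP => b; rewrite finset.in_setU1 finset.in_setD1 mG !inE.
by rewrite /rewired aS aS' kT NGxv ay eqxx /= orbC andbC.
Qed.

Section Gain.
Variables (R : realType) (alpha : R) (t : 'I_n) (G' : digraph n).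
Hypotheses (alpha_gt0 : 0 < alpha) (alpha_lt1 : alpha < 1).
Hypothesis G'E : (G' : rel 'I_n) = rewired.

(** Outside [B] out-degrees agree and no arc but (y, v) is lost, so there the [ppr] of [G'] is a
    supersolution for the kernel [del_step] and [value_avoid] applies. *)
Lemma rewired_ppr (i : nat) :
  value alpha G t (del_step alpha G keep y v) i v
  - \sum_(b in B) value_via alpha G t (del_step alpha G keep y v) b i v
  <= ppr alpha G' v t.
Proof.
have Q_ge0 := del_step_ge0 G alpha_gt0 alpha_lt1 keep y v.
have F_ge0 := ppr_ge0 G' t alpha_gt0 alpha_lt1.
apply: (value_avoid alpha_gt0 alpha_lt1 Q_ge0 F_ge0).
move=> a aB; rewrite [leRHS](pprE G' t alpha_gt0 alpha_lt1).
have deg : outdeg G a = outdeg G' a.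
  by rewrite /outdeg G'E; apply: rewired_outdeg.
apply: lerD.
  rewrite /start_stop; case: eqP => [at_|]; last by rewrite !mul0r.
  by rewrite /stop_prob -at_ deg.
apply: ler_sum => b _; rewrite ler_wpM2r ?ppr_ge0 //.
rewrite /del_step; case: ifP => [_|nd]; first exact: step_prob_ge0.
rewrite /step_prob -deg G'E.
have [Gab|_] := boolP (G a b); last first.
  by case: ifP => // _; rewrite divr_ge0 ?ler0n // subr_ge0 ltW.
by have [//|/(rewired_del aB Gab)] := boolP (rewired a b); rewrite nd.
Qed.

(** Two hops, feeder to hub to [v]. After pruning, the out-neighbours of a vertex of [S] are its
    target and vertices of [H], at most h + 1 in all. *)
Lemma rewired_pagerank (h : nat) : (#|H| <= h)%N -> x \notin S0 ->
  #|S0|%:R / n%:R * ((1 - alpha) / h.+1%:R) ^+ 2 * ppr alpha G' v t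
    <= pagerank alpha G' t.
Proof.
move=> Hh xS0; set c := (1 - alpha) / h.+1%:R.
have c0 : 0 <= c by rewrite divr_ge0 ?ler0n // subr_ge0 ltW.
have hop a : a \in S ->
    c * ppr alpha G' (if a == x then v else x) t <= ppr alpha G' a t.
  move=> aS; apply: le_trans (ppr_step G' t alpha_gt0 alpha_lt1 a (if a == x then v else x)).
  rewrite ler_wpM2r ?ppr_ge0 // /step_prob.
  have G'a : G' a (if a == x then v else x).
    by rewrite G'E /rewired aS /pruned eqxx.
  rewrite G'a; apply: ler_wpM2l; first by rewrite subr_ge0 ltW.
  rewrite lef_pV2 ?posrE ?ltr0n // ?ler_nat.
    rewrite /outdeg (@leq_trans #|(if a == x then v else x) |: H|) //.
      apply: subset_leq_card; apply/fintype.subsetP => b; rewrite !inE G'E.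
      by rewrite /rewired aS => /orP[->//|/andP[-> _]]; rewrite orbT.
    by rewrite cardsU1 -add1n leq_add // leq_b1.
  by rewrite /outdeg; apply/card_gt0P; exists (if a == x then v else x).
have fx : c * ppr alpha G' v t <= ppr alpha G' x t.
  by have := hop x; rewrite eqxx; apply; rewrite !inE eqxx.
apply: (@le_trans _ _ (\sum_(a in S0) ppr alpha G' a t / n%:R)); last first.
  rewrite /pagerank [leRHS](bigID (mem S0)) /= lerDl.
  by apply: sumr_ge0 => a _; rewrite divr_ge0 ?ler0n // ppr_ge0.
apply: (@le_trans _ _ (\sum_(a in S0) (c ^+ 2 * ppr alpha G' v t) / n%:R)).
  rewrite sumr_const -[leRHS]mulr_natl le_eqVlt; apply/orP; left; apply/eqP; ring.
apply: ler_sum => a aS0; rewrite ler_wpM2r ?invr_ge0 ?ler0n //.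
have /hop : a \in S by rewrite !inE aS0 orbT.
have /negPf -> : a != x by apply: contraNneq xS0 => <-.
by apply: le_trans; rewrite expr2 -mulrA ler_wpM2l.
Qed.

End Gain.
End Gadget.

(** * Averaging over the random choices *)

(** First-moment method: an average weight below 1 leaves a choice for which every nonnegative part
    of the weight is below 1. *)
Lemma exists_light (R : realType) (I : finType) (D : {pred I}) (w : I -> R) :
  \sum_(c in D) w c < #|D|%:R -> exists2 c, c \in D & w c < 1.
Proof.
move=> lt_sum; apply: contrapT => none.
have: #|D|%:R <= \sum_(c in D) w c.
  rewrite -sum1_card natr_sum; apply: ler_sum => c cD.
  by rewrite leNgt; apply/negP => wc; apply: none; exists c.
by rewrite leNgt lt_sum.
Qed.

(** The blocks miss fewer than M <= eps n / 2 vertices, so at least eps n / 2 slots lie in [W];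
    dividing by 2m and using M m <= n gives eps M / 4. *)
Lemma card_samples_few_dense (R : realType) (n M m : nat) (Mm_le : (M * m <= n)%N)
    (eps : R) (W : {set 'I_n}) (k : nat) :
  m = (n %/ M)%N -> (0 < m)%N -> M%:R <= eps * n%:R / 2 -> eps * n%:R <= #|W|%:R ->
  (#|[pred sigma | (#|sample Mm_le sigma :&: W| < k)%N]|%:R : R) <=
  (m ^ M)%:R * (2 ^+ k * expR (- (eps * M%:R / 4))).
Proof.
move=> mE m_gt0 M_le W_ge; apply: le_trans (card_samples_few _ _ _ _ _) _ => //.
have M_gt0 : (0 < M)%N.
  by rewrite lt0n; apply: contraTneq m_gt0 => M0; rewrite mE M0 divn0.
rewrite -[leLHS]mulrA; apply: ler_wpM2l => //; apply: ler_wpM2l; first exact: exprn_ge0.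
rewrite ler_expR lerN2.
have mR : 0 < m%:R :> R by rewrite ltr0n.
have nR : M%:R * m%:R <= n%:R :> R by rewrite -natrM ler_nat.
rewrite ler_pdivlMr ?mulr_gt0 //.
have rest : (n - M * m)%:R <= M%:R :> R.
  rewrite ler_nat mE leq_subLR mulnC [leqLHS](divn_eq n M) leq_add2l.
  by rewrite ltnW // ltn_pmod.
have := card_slots Mm_le W; rewrite -(ler_nat R) natrD => slots.
have H1 : eps * n%:R / 2 <= (\sum_i \sum_j (slot Mm_le i j \in W))%:R by lra.
have eps_ge0 : 0 <= eps.
  have : 0 < M%:R :> R by rewrite ltr0n.
  have : 0 < n%:R :> R by apply: lt_le_trans nR; rewrite mulr_gt0 ?ltr0n.
  move=> n0 M0; have : 0 < eps * n%:R / 2 by apply: lt_le_trans M_le.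
  by rewrite -mulrA pmulr_lgt0 ?divr_gt0 // => /ltW.
have H2 : eps * (M%:R * m%:R) <= eps * n%:R by rewrite ler_wpM2l.
lra.
Qed.

Section FiniteRewiring.
Variables (R : realType) (alpha : R) (n : nat) (G : digraph n) (t : 'I_n).
Hypotheses (alpha_gt0 : 0 < alpha) (alpha_lt1 : alpha < 1).
Variables (M m s h : nat) (Mm_le : (M.+1 * m <= n)%N) (sM : (s <= M)%N).
Variables (H : {set 'I_n}) (H_le : (#|H| <= h)%N) (keep : bool).

Local Notation Q y v := (del_step alpha G keep y v).
Local Notation val := (value alpha G t).
Local Notation via := (value_via alpha G t).

Definition spoiled (q : query n) (yv : 'I_n * 'I_n) : bool :=
  if keep then probed_arc G q == Some yv else probed_head q == Some yv.2.

Lemma sampled_rewiring (sigma : {ffun 'I_M.+1 -> 'I_m}) (y v : 'I_n) :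
  let B := sample Mm_le sigma in
  (forall b, b \notin H -> (2 * s.+1 <= #|B :&: [set a | ~~ G a b]%SET|)%N) ->
  v \notin B ->
  (keep -> [/\ G y v, y \notin B & exists2 z, z \in B & ~~ G y z]) ->
  exists G' : digraph n,
    (forall x q, reply G x q <> reply G' x q ->
       has (mem B) (mentioned G q) || spoiled q (y, v)) /\
    (forall i, s%:R / n%:R * ((1 - alpha) / h.+1%:R) ^+ 2 *
       (val (Q y v) i v - \sum_(b in B) via (Q y v) b i v)
       <= pagerank alpha G' t).
Proof.
move=> B hits vB keepP.
(* Draw 0 is the hub, draws 1 to s are the feeders, and the rest absorb. *)
pose x := draw Mm_le sigma ord0.
pose f (i : 'I_s) := draw Mm_le sigma (inord i.+1).
pose S0 := [set f i | i : 'I_s]%SET.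
pose S' := B :\: (x |: S0).
have valf (i : 'I_s) : (inord i.+1 : 'I_M.+1) = i.+1 :> nat.
  by rewrite inordK // ltnS (leq_trans (ltn_ord i)).
have cardS0 : #|S0| = s.
  rewrite card_imset ?card_ord // => i j /draw_inj/(congr1 (@nat_of_ord _)).
  by rewrite !valf => -[/val_inj].
have xS0 : x \notin S0.
  apply/imsetP => -[i _ /draw_inj/(congr1 (@nat_of_ord _))].
  by rewrite valf.
have cardS : #|x |: S0| = s.+1 by rewrite cardsU1 xS0 cardS0.
have SB : x |: S0 \subset B.
  apply/fintype.subsetP => u /setU1P[->|/imsetP[i _ ->]]; exact: imset_f.
have BE : x |: S0 :|: S' = B.
  by rewrite /S' finset.setDE finset.setUIr finset.setUCr finset.setIT; apply/finset.setUidPr.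
(* Without a trade [z] is a dummy, for which the hub serves. *)
have [z zP] : exists z, keep -> [/\ G y v, y \notin B, z \in B & ~~ G y z].
  case: (keep) keepP => [/(_ isT)[? ? [z ? ?]]|_]; first by exists z.
  by exists x.
have disj u : u \in x |: S0 -> u \notin S' by move=> uS; rewrite finset.in_setD uS.
(* Of the 2 (s + 1) hits in [B], the hub and the feeders take at most s + 1. *)
have spare b : b \notin H -> (#|x |: S0| <= #|[set a in S' | ~~ G a b]%SET|)%N.
  rewrite cardS => /hits; set W := [set a | _]%SET.
  rewrite (_ : [set a in S' | _]%SET = (B :&: W) :\: (x |: S0)); last first.
    apply/setP => a; rewrite !inE; case: (_ || _) => //=.
  rewrite -(cardsID (x |: S0) (B :&: W)) => hB.
  have : (#|B :&: W :&: (x |: S0)| <= s.+1)%N.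
    by rewrite (leq_trans (subset_leq_card (finset.subsetIr _ _))) // cardS.
  move=> A_le; have := leq_trans hB (leq_add A_le (leqnn _)).
  by rewrite mul2n -addnn leq_add2l.
have [G' [G'E inS outS]] := rewire G (rewired G H S0 S' x v keep y z).
have vB' : v \notin x |: S0 :|: S' by rewrite BE.
have zP' : keep -> [/\ G y v, y \notin x |: S0 :|: S', z \in x |: S0 :|: S' & ~~ G y z].
  by rewrite BE.
exists G'; split=> [w q|i].
  apply: reply_neq; rewrite ?G'E //.
  - by move=> a b aB bB; apply: (rewired_outside zP'); rewrite ?BE.
  - move=> b bB kb; rewrite /indeg G'E.
    by apply: (rewired_indeg disj vB' zP' spare); rewrite ?BE.
  - by move=> a aB; rewrite /outdeg G'E; apply: (rewired_outdeg _ zP'); rewrite BE.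
rewrite -[s in leLHS]cardS0.
apply: le_trans (rewired_pagerank t alpha_gt0 alpha_lt1 G'E H_le xS0).
apply: ler_wpM2l.
  by rewrite mulr_ge0 ?exprn_ge0 ?divr_ge0 ?ler0n // subr_ge0 ltW.
have := rewired_ppr zP' t alpha_gt0 alpha_lt1 G'E i.
by rewrite BE.
Qed.

Section Averaging.
Variables (eps r E : R) (HO : {set 'I_n}) (TT : {set 'I_n * 'I_n}) (l : nat).
Variable A : algorithm R n.
Hypotheses (mE : m = (n %/ M.+1)%N) (M_le : M.+1%:R <= eps * n%:R / 2).
Hypothesis dense_in :
  forall b, b \notin H -> eps * n%:R <= #|[set a | ~~ G a b]%SET|%:R.
Hypothesis dense_out :
  forall a, a \notin HO -> eps * n%:R <= #|[set b | ~~ G a b]%SET|%:R.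
Hypothesis chernoff :
  2 * n%:R * (2 ^+ (2 * s.+1) * expR (- (eps * M.+1%:R / 4))) <= 1 / 8.
Hypothesis lm : (8 * l.+1 <= m)%N.
Hypotheses (r_gt0 : 0 < r) (tail : (1 - alpha) ^+ l <= alpha * r / 2).
Hypothesis TT_gt0 : (0 < #|TT|)%N.
Hypothesis TT_ppr : forall yv, yv \in TT -> r <= ppr alpha G yv.2 t.
Hypothesis TT_keep : keep ->
  forall yv, yv \in TT -> G yv.1 yv.2 && (yv.1 \notin HO).
Hypothesis TT_inj : ~~ keep -> {in TT &, injective (@snd 'I_n 'I_n)}.
Hypothesis timeE : (expected_time A G <= E%:E)%E.

Local Notation ffunT := {ffun 'I_M.+1 -> 'I_m}.
Local Notation B := (sample Mm_le).
Let N : R := (m ^ M.+1)%:R.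

Local Lemma m_gt0 : (0 < m)%N.
Proof. by apply: leq_trans lm; rewrite muln_gt0. Qed.

Local Lemma N_gt0 : 0 < N.
Proof. by rewrite ltr0n expn_gt0 m_gt0. Qed.

Lemma sum_samples_containing b :
  \sum_(sigma : ffunT) (b \in B sigma)%:R <= N / m%:R.
Proof.
rewrite ler_pdivlMr ?ltr0n ?m_gt0 // -natr_sum -natrM ler_nat.
apply: leq_trans (card_samples_containing Mm_le b).
by rewrite leq_mul2r -sum1_card [X in (_ <= X)%N]big_mkcond leqnn orbT.
Qed.

(** The first clause supplies absorbers, the second the vertex [z] for the trade; a common threshold
    lets one Chernoff bound serve both. *)
Definition well_spread (sigma : ffunT) : bool :=
  [forall b, (b \in H) ||
     (2 * s.+1 <= #|B sigma :&: [set a | ~~ G a b]%SET|)%N] &&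
  [forall a, (a \in HO) ||
     (2 * s.+1 <= #|B sigma :&: [set b | ~~ G a b]%SET|)%N].

Lemma sum_not_well_spread :
  \sum_(sigma : ffunT) (~~ well_spread sigma)%:R <= N / 8.
Proof.
pose bad (W : {set 'I_n}) (sigma : ffunT) : R :=
  (#|B sigma :&: W| < 2 * s.+1)%N%:R.
pose nonin b := [set a | ~~ G a b]%SET; pose nonout a := [set b | ~~ G a b]%SET.
pose X : R := 2 ^+ (2 * s.+1) * expR (- (eps * M.+1%:R / 4)).
have badle (W : {set 'I_n}) : eps * n%:R <= #|W|%:R -> \sum_(sigma : ffunT) bad W sigma <= N * X.
  move=> /(card_samples_few_dense Mm_le (2 * s.+1) mE m_gt0 M_le).
  by apply: le_trans; rewrite -natr_sum -sum1_card ler_nat [leqRHS]big_mkcond.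
apply: (@le_trans _ _ (\sum_(sigma : ffunT)
    (\sum_(b | b \notin H) bad (nonin b) sigma +
     \sum_(a | a \notin HO) bad (nonout a) sigma))).
  apply: ler_sum => sigma _; rewrite /well_spread negb_and.
  have sum0 (P : pred 'I_n) (f : 'I_n -> {set 'I_n}) :
      0 <= \sum_(b | P b) bad (f b) sigma by apply: sumr_ge0.
  have sum1 (P : pred 'I_n) (f : 'I_n -> {set 'I_n}) b : P b ->
      (#|B sigma :&: f b| < 2 * s.+1)%N -> 1 <= \sum_(b | P b) bad (f b) sigma.
    move=> Pb few; rewrite (bigD1 b) //= /bad few lerDl.
    by apply: sumr_ge0.
  rewrite !negb_forall; case: existsP => [[b]|_] /=.
    rewrite negb_or -ltnNge => /andP[bH few]; rewrite -[leLHS]addr0 lerD //.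
    exact: (sum1 (fun b => b \notin H) nonin b).
  case: existsP => [[a]|_]; last by rewrite addr_ge0.
  rewrite negb_or -ltnNge => /andP[aHO few]; rewrite -[leLHS]add0r lerD //.
  exact: (sum1 (fun a => a \notin HO) nonout a).
have sumle (P : pred 'I_n) (f : 'I_n -> {set 'I_n}) :
    (forall b, P b -> eps * n%:R <= #|f b|%:R) ->
    \sum_(sigma : ffunT) \sum_(b | P b) bad (f b) sigma <= n%:R * (N * X).
  move=> dense; rewrite exchange_big /=.
  apply: (@le_trans _ _ (\sum_(b < n) N * X)).
    rewrite big_mkcond; apply: ler_sum => b _; case: ifP => [/dense/badle//|_].
    by rewrite mulr_ge0 ?(ltW N_gt0) // mulr_ge0 ?exprn_ge0 ?expR_ge0.
  by rewrite sumr_const card_ord mulr_natl.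
rewrite big_split /=.
have H1 := sumle (fun b => b \notin H) nonin dense_in.
have H2 := sumle (fun a => a \notin HO) nonout dense_out.
apply: le_trans (lerD H1 H2) _.
have : N * (2 * n%:R * X) <= N * (1 / 8).
  by rewrite ler_wpM2l // (ltW N_gt0).
lra.
Qed.

(** A query probes at most one arc and has at most one head; without a trade, members of [TT] are
    determined by their heads. *)
Lemma card_spoiled q : (#|[set yv in TT | spoiled q yv]%SET| <= 1)%N.
Proof.
apply/card_le1P => yv; rewrite inE => /andP[yvT sp] yv'; rewrite !inE.
apply/idP/eqP => [/andP[yv'T]|->]; last by rewrite yvT.
move: sp; rewrite /spoiled; case: ifPn => [_ /eqP -> /eqP[]//|/TT_inj inj].
by move=> /eqP -> /eqP[] /esym /inj; apply.
Qed.

(** Detection probability of one query: it mentions at most two vertices, each in the sample with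
    probability at most 1 / m, and spoils at most one member of [TT]. *)
Let rate : R := 2 / m%:R + 1 / #|TT|%:R.

Lemma averaged_rewiring : exists G' : digraph n,
  s%:R / n%:R * ((1 - alpha) / h.+1%:R) ^+ 2 * (alpha * r / 4)
    <= pagerank alpha G' t /\
  ((1 - 4 * rate * E)%:E <= same_output_prob A G' G)%E.
Proof.
pose T : R := #|TT|%:R.
have T_gt0 : 0 < T by rewrite ltr0n.
have mR_gt0 : 0 < m%:R :> R by rewrite ltr0n m_gt0.
have N0 := N_gt0.
have card_ffunT : #|{: ffunT}|%:R = N by rewrite card_ffun !card_ord.
have E_ge1 : 1 <= E.
  rewrite -lee_fin; apply: le_trans timeE; rewrite expected_time_asking.
  by rewrite leeDl // nneseries_ge0.
pose good (c : ('I_n * 'I_n) * ffunT) := [&& c.1 \in TT, well_spread c.2,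
  c.1.2 \notin B c.2 & c.1.1 \notin B c.2].
(* Unusable choices get [G] itself, which no query can tell apart. *)
have /boolp.choice[Gc GcP] : forall c, exists G', if good c then
    (forall x q, reply G x q <> reply G' x q ->
       has (mem (B c.2)) (mentioned G q) || spoiled q c.1) /\
    (forall i, s%:R / n%:R * ((1 - alpha) / h.+1%:R) ^+ 2 *
       (val (Q c.1.1 c.1.2) i c.1.2 - \sum_(b in B c.2) via (Q c.1.1 c.1.2) b i c.1.2)
       <= pagerank alpha G' t)
   else G' = G.
  move=> [[y v] sigma]; have [gc|_] := boolP (good (y, v, sigma)); last by exists G.
  have /and4P[/= yvT /andP[/forallP hin /forallP hout] vB yB] := gc.
  apply: (sampled_rewiring (sigma := sigma)) => //.
    by move=> b /negPf bH; have := hin b; rewrite bH.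
  move=> kT; have /andP[/= Gyv /negPf yHO] := TT_keep kT yvT.
  split=> //; have := hout y; rewrite yHO /= => /(leq_trans (ltn0Sn _)).
  by rewrite card_gt0 => /set0Pn[z]; rewrite !inE => /andP[zB NG]; exists z.
have sum_pairs (f : ('I_n * 'I_n) * ffunT -> R) :
    \sum_(c | c.1 \in TT) f c = \sum_(yv in TT) \sum_(sigma : ffunT) f (yv, sigma).
  by rewrite pair_big /=; apply: eq_big => [[yv sigma]|[yv sigma] _] //=; rewrite andbT.
pose p : R := T * (2 * (N / m%:R)) + N.
have p_ge0 : 0 <= p by rewrite addr_ge0 ?mulr_ge0 ?invr_ge0 // ltW.
have pE : p = T * N * rate by rewrite /p /rate; field; rewrite !lt0r_neq0.
have differ x q :
    (#|[pred c | `[< reply G x q <> reply (Gc c) x q >]]|%:R <= p)%R.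
  apply: (@le_trans _ _ (\sum_(c : ('I_n * 'I_n) * ffunT | c.1 \in TT)
      (\sum_(b <- mentioned G q) (b \in B c.2)%:R + (spoiled q c.1)%:R))).
    rewrite -sum1_card natr_sum big_mkcond [leRHS]big_mkcond /=.
    apply: ler_sum => c _.
    have nonneg : 0 <= \sum_(b <- mentioned G q) (b \in B c.2)%:R + (spoiled q c.1)%:R :> R.
      by rewrite addr_ge0 // sumr_ge0.
    rewrite inE; case: asboolP => [D|_]; last by case: ifP.
    have := GcP c; case: ifP => [/and4P[-> _ _ _] [/(_ x q D) sp _]|_ GcE].
      case/orP: sp => [/hasP[b bq bB]|->]; last by rewrite lerDr sumr_ge0.
      rewrite (big_rem b) //= [b \in _]bB -addrA lerDl addr_ge0 // sumr_ge0 //.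
    by move: D; rewrite GcE.
  rewrite sum_pairs.
  apply: (@le_trans _ _ (\sum_(yv in TT)
      (2 * (N / m%:R) + N * (spoiled q yv)%:R))).
    apply: ler_sum => yv _; rewrite big_split /=; apply: lerD; last first.
      by rewrite sumr_const -[leLHS]mulr_natl card_ffunT.
    rewrite exchange_big /=.
    apply: (@le_trans _ _ (\sum_(b <- mentioned G q) N / m%:R)).
      by apply: ler_sum => b _; apply: sum_samples_containing.
    rewrite big_const_seq iter_addr_0 count_predT -[leLHS]mulr_natl.
    rewrite ler_wpM2r ?divr_ge0 ?(ltW N0) ?(ltW mR_gt0) //.
    by rewrite ler_nat size_mentioned.
  rewrite big_split /= sumr_const -mulr_sumr -[_ *+ _]mulr_natl lerD2l.
  rewrite ler_piMr ?(ltW N0) // -natr_sum lern1.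
  apply: leq_trans (card_spoiled q).
  rewrite -sum1_card big_mkcond [leqRHS]big_mkcond; apply: leq_sum => yv _.
  by rewrite inE; case: (_ \in TT).
have [e [e_ge0 e_sop e_sum]] := average_detection p_ge0 timeE differ.
have rate_gt0 : 0 < rate by rewrite addr_gt0 ?divr_gt0.
(* [e] averages at most [rate * E] over the choices with hidden item in [TT], so [e c / delta]
   averages at most 1/4. *)
pose delta := 4 * rate * E.
have delta_gt0 : 0 < delta by rewrite !mulr_gt0 // (lt_le_trans ltr01).
pose vl yv := val (Q yv.1 yv.2) l yv.2.
pose loss (c : ('I_n * 'I_n) * ffunT) :=
  \sum_(b in B c.2) via (Q c.1.1 c.1.2) b l c.1.2.
have Q_ge0 y v := del_step_ge0 G alpha_gt0 alpha_lt1 keep y v.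
(* Deleting the arc leaves alpha times the [ppr], hence alpha r, and [tail] lets truncation cost at
   most half of that. *)
have vl_ge yv : yv \in TT -> alpha * r / 2 <= vl yv.
  move=> yvT; apply: le_trans (value_del_step G t alpha_gt0 alpha_lt1 _ _ _ _ _).
  have H1 := ppr_trunc_tail G t alpha_gt0 alpha_lt1 l yv.2.
  have : alpha * r <= alpha * ppr alpha G yv.2 t.
    by rewrite ler_wpM2l ?(ltW alpha_gt0) // TT_ppr.
  by move: H1 tail; lra.
have vl_gt0 yv : yv \in TT -> 0 < vl yv.
  by move=> /vl_ge; apply: lt_le_trans; rewrite divr_gt0 // mulr_gt0.
have loss_ge0 c : 0 <= loss c.
  by apply: sumr_ge0 => b _; apply: value_via_ge0.
(* Each term reaches 1 when its requirement fails. The averages are at most 1/8, 1/m, 1/m and 2l/m,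
   in total 3/8 by [lm]; with the 1/4 from detection this stays below 1. *)
pose w1 (c : ('I_n * 'I_n) * ffunT) : R := (~~ well_spread c.2)%:R +
  (c.1.2 \in B c.2)%:R + (c.1.1 \in B c.2)%:R + loss c / (vl c.1 / 2).
have w1_sum yv : yv \in TT ->
    \sum_(sigma : ffunT) w1 (yv, sigma) <= 3 / 8 * N.
  move=> yvT; have vl0 := vl_gt0 _ yvT; rewrite /w1 !big_split /=.
  have H1 := sum_not_well_spread.
  have H2 := sum_samples_containing yv.2; have H3 := sum_samples_containing yv.1.
  have H4 : \sum_(sigma : ffunT) loss (yv, sigma) / (vl yv / 2)
      <= 2 * l%:R * (N / m%:R).
    rewrite -mulr_suml ler_pdivrMr ?divr_gt0 //.
    apply: (@le_trans _ _ (\sum_b via (Q yv.1 yv.2) b l yv.2 * (N / m%:R))).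
      rewrite /loss /=; under eq_bigr do rewrite big_mkcond /=.
      rewrite exchange_big; apply: ler_sum => b _ /=.
      rewrite (eq_bigr (fun sigma : ffunT =>
        via (Q yv.1 yv.2) b l yv.2 * (b \in B sigma)%:R)); last first.
        by move=> sigma _; case: ifP; rewrite ?mulr1 ?mulr0.
      rewrite -mulr_sumr ler_wpM2l ?sum_samples_containing //.
      exact: value_via_ge0.
    rewrite -mulr_suml.
    have := sum_value_via G t alpha_gt0 alpha_lt1 (Q_ge0 yv.1 yv.2) l yv.2.
    rewrite -/(vl yv) => viaH.
    have NM : 0 <= N / m%:R by rewrite divr_ge0 ?ltW.
    by have := ler_wpM2r NM viaH; lra.
  have H5 : l.+1%:R * (N / m%:R) <= N / 8.
    rewrite mulrA ler_pdivrMr //.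
    have : (8 * l.+1)%:R <= m%:R :> R by rewrite ler_nat.
    rewrite natrM => mH; have := ler_wpM2l (ltW N0) mH; lra.
  by move: H1 H2 H3 H4 H5; rewrite -natr1; lra.
have [|c cT wc] := @exists_light R _ [pred c | c.1 \in TT]
    (fun c => w1 c + e c / delta).
  rewrite big_split /=.
  have card_conf : #|[pred c : ('I_n * 'I_n) * ffunT | c.1 \in TT]|%:R = T * N.
    rewrite -sum1_card natr_sum sum_pairs.
    under eq_bigr do rewrite sumr_const card_ffunT.
    by rewrite sumr_const -[LHS]mulr_natl.
  rewrite card_conf.
  have S1 : \sum_(c | c.1 \in TT) w1 c <= T * (3 / 8 * N).
    rewrite sum_pairs; apply: le_trans (ler_sum _ w1_sum) _.
    by rewrite sumr_const -[leLHS]mulr_natl.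
  have S2 : \sum_(c | c.1 \in TT) e c / delta <= T * N / 4.
    rewrite -mulr_suml ler_pdivrMr //.
    apply: (@le_trans _ _ (\sum_c e c)).
      by rewrite [leRHS](bigID (fun c => c.1 \in TT)) /= lerDl sumr_ge0.
    by apply: le_trans e_sum _; rewrite pE /delta; lra.
  apply: le_lt_trans (lerD S1 S2) _.
  have : 0 < T * N by rewrite mulr_gt0.
  lra.
have ed_ge0 : 0 <= e c / delta by rewrite divr_ge0 // ltW.
have ls_ge0 : 0 <= loss c / (vl c.1 / 2) by rewrite divr_ge0 // divr_ge0 // ltW ?vl_gt0.
have b01 (b : bool) : 0 <= b%:R :> R by [].
have small (b : bool) : b%:R < 1 :> R -> ~~ b by case: b; rewrite ?ltxx.
have g1 : well_spread c.2.
  apply/negPn/small; apply: le_lt_trans wc; rewrite /w1.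
  by have := b01 (c.1.2 \in B c.2); have := b01 (c.1.1 \in B c.2); lra.
have g2 : c.1.2 \notin B c.2.
  apply: small; apply: le_lt_trans wc; rewrite /w1.
  by have := b01 (~~ well_spread c.2); have := b01 (c.1.1 \in B c.2); lra.
have g3 : c.1.1 \notin B c.2.
  apply: small; apply: le_lt_trans wc; rewrite /w1.
  by have := b01 (~~ well_spread c.2); have := b01 (c.1.2 \in B c.2); lra.
have g4 : loss c < vl c.1 / 2.
  rewrite -[ltRHS]mul1r -ltr_pdivrMr ?divr_gt0 ?vl_gt0 //.
  apply: le_lt_trans wc; rewrite /w1.
  by have := b01 (~~ well_spread c.2); have := b01 (c.1.2 \in B c.2);
    have := b01 (c.1.1 \in B c.2); lra.
have g5 : e c <= delta.
  rewrite -[leRHS]mul1r -ler_pdivrMr // ltW //.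
  apply: le_lt_trans wc; rewrite /w1.
  by have := b01 (~~ well_spread c.2); have := b01 (c.1.2 \in B c.2);
    have := b01 (c.1.1 \in B c.2); lra.
exists (Gc c); split; last first.
  by apply: le_trans (e_sop c); rewrite lee_fin lerD2l lerN2.
have := GcP c; rewrite /good [c.1 \in TT]cT g1 g2 g3 => -[_ /(_ l)].
apply: le_trans; apply: ler_wpM2l.
  by rewrite mulr_ge0 ?exprn_ge0 ?divr_ge0 ?ler0n // subr_ge0 ltW.
have := vl_ge _ cT; move: g4; rewrite /loss /vl; lra.
Qed.

End Averaging.
End FiniteRewiring.

(** * Choosing the hidden item *)

Section VolumeSplit.
Variables (R : realType) (alpha : R) (n : nat) (G : digraph n) (t : 'I_n).
Variables (eps r : R) (h : nat).
Hypotheses (alpha_gt0 : 0 < alpha) (alpha_lt1 : alpha < 1).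
Hypothesis hdeg : (#|[pred v | ((1 - eps) * n%:R < (indeg G v)%:R)%R
              || ((1 - eps) * n%:R < (outdeg G v)%:R)%R]| <= h)%N.

Let H : {set 'I_n} := [set v | (1 - eps) * n%:R < (indeg G v)%:R]%SET.
Let HO : {set 'I_n} := [set v | (1 - eps) * n%:R < (outdeg G v)%:R]%SET.
Let V : {set 'I_n} := [set v | r <= ppr alpha G v t]%SET.
Let arcs : {set 'I_n * 'I_n} :=
  [set p | [&& G p.1 p.2, p.2 \in V & p.1 \notin HO]]%SET.

Local Lemma card_high_in : (#|H| <= h)%N.
Proof.
apply: leq_trans hdeg; apply: subset_leq_card; apply/fintype.subsetP => v.
by rewrite !inE => ->.
Qed.

Local Lemma card_high_out : (#|HO| <= h)%N.
Proof.
apply: leq_trans hdeg; apply: subset_leq_card; apply/fintype.subsetP => v.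
by rewrite !inE => ->; rewrite orbT.
Qed.

Local Lemma card_compl (P : pred 'I_n) :
  #|[pred u | P u]|%:R <= (1 - eps) * n%:R ->
  eps * n%:R <= #|[set u | ~~ P u]%SET|%:R.
Proof.
have /(congr1 (fun k => k%:R : R)) := cardC [pred u | P u].
rewrite card_ord natrD => E; rewrite cardsE.
rewrite (_ : #|[pred u | ~~ P u]| = #|[predC [pred u | P u]]|); last by apply: eq_card.
by move: E; lra.
Qed.

(** For each v in [V] at most h in-neighbours lie in [HO]; together with the summand 1 they give h +
    1, and the other in-arcs belong to [arcs]. *)
Local Lemma in_volume_le : (in_volume alpha G r t <= h.+1 * #|V| + #|arcs|)%N.
Proof.
rewrite /in_volume (eq_bigl (fun v => v \in V)); last by move=> v; rewrite inE.
have -> : #|arcs| = (\sum_(v in V) #|[set u | G u v && (u \notin HO)]%SET|)%N.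
  rewrite -sum1_card (eq_bigl (fun p : 'I_n * 'I_n =>
    (p.2 \in V) && (G p.1 p.2 && (p.1 \notin HO)))); last first.
    by move=> p; rewrite !inE andbCA.
  rewrite -(pair_big_dep (fun u => true)
      (fun u v => (v \in V) && (G u v && (u \notin HO))) (fun _ _ => 1%N)) /=.
  rewrite (exchange_big_dep (fun v => v \in V)) /=; last by move=> u v _ /andP[].
  apply: eq_bigr => v vV; rewrite -sum1_card; apply: eq_bigl => u.
  by rewrite inE vV.
rewrite mulnC -sum_nat_const -big_split /=; apply: leq_sum => v vV.
rewrite add1n addSn ltnS.
rewrite /indeg -cardsE -(cardsID HO) leq_add //.
  by apply: leq_trans card_high_out; apply: subset_leq_card; exact: finset.subsetIr.
apply: subset_leq_card; apply/fintype.subsetP => u.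
by rewrite !inE => /andP[-> ->].
Qed.

Lemma finite_rewiring (A : algorithm R n) (E : R) (s M l : nat) :
  let m := (n %/ M.+1)%N in let T := in_volume alpha G r t in
  (s <= M)%N -> M.+1%:R <= eps * n%:R / 2 ->
  2 * n%:R * (2 ^+ (2 * s.+1) * expR (- (eps * M.+1%:R / 4))) <= 1 / 8 ->
  (8 * l.+1 <= m)%N -> 0 < r -> (1 - alpha) ^+ l <= alpha * r / 2 ->
  (0 < T)%N -> (expected_time A G <= E%:E)%E ->
  exists G' : digraph n,
    s%:R / n%:R * ((1 - alpha) / h.+1%:R) ^+ 2 * (alpha * r / 4)
      <= pagerank alpha G' t /\
    ((1 - 8 * (1 / m%:R + h.+1%:R / T%:R) * E)%:E <= same_output_prob A G' G)%E.
Proof.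
move=> m T sM M_le chern lm r_gt0 tail T_gt0 timeE.
have Mm_le : (M.+1 * m <= n)%N by rewrite mulnC leq_divM.
have dense_in b : b \notin H -> eps * n%:R <= #|[set a | ~~ G a b]%SET|%:R.
  by rewrite inE -leNgt => bH; apply: card_compl.
have dense_out a : a \notin HO -> eps * n%:R <= #|[set b | ~~ G a b]%SET|%:R.
  by rewrite inE -leNgt => bH; apply: card_compl.
suff [keep [TT [T_le TT_ppr TT_keep TT_inj]]] : exists (keep : bool) (TT : {set 'I_n * 'I_n}),
   [/\ (T <= 2 * h.+1 * #|TT|)%N, forall yv, yv \in TT -> r <= ppr alpha G yv.2 t,
     keep -> forall yv, yv \in TT -> G yv.1 yv.2 && (yv.1 \notin HO) &
     ~~ keep -> {in TT &, injective (@snd 'I_n 'I_n)}].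
  have TT_gt0 : (0 < #|TT|)%N.
    by rewrite lt0n; apply: contraTneq T_le => ->; rewrite muln0 -ltnNge.
  have [G' [prG' sopG']] := averaged_rewiring alpha_gt0 alpha_lt1 Mm_le sM
    card_high_in erefl M_le dense_in dense_out chern lm r_gt0 tail TT_gt0
    TT_ppr TT_keep TT_inj timeE.
  exists G'; split=> //; apply: le_trans sopG'; rewrite lee_fin lerD2l lerN2.
  have E_ge0 : 0 <= E.
    rewrite -lee_fin; apply: le_trans timeE.
    by rewrite expected_time_asking adde_ge0 // nneseries_ge0.
  rewrite ler_wpM2r //.
  have TR : 0 < T%:R :> R by rewrite ltr0n.
  have TTR : 0 < #|TT|%:R :> R by rewrite ltr0n.
  have : 1 / #|TT|%:R <= 2 * (h.+1%:R / T%:R) :> R.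
    rewrite mulrA ler_pdivrMr // mulrAC ler_pdivlMr // mul1r.
    by rewrite -!natrM ler_nat.
  rewrite [2 / m%:R](_ : _ = 2 * (1 / m%:R)); first by lra.
  by rewrite mulrA mulr1.
(* If [V] is small, [in_volume_le] leaves at least T / 2 arcs. *)
have [V_big|V_small] := leqP T (2 * h.+1 * #|V|).
  (* Without a trade [y] is a dummy; y = v adds no new requirement. *)
  exists false, [set (v, v) | v in V]%SET; split=> //.
  - by rewrite card_imset // => u v [].
  - by move=> _ /imsetP[v vV ->]; move: vV; rewrite inE.
  - by move=> _ p q /imsetP[u _ ->] /imsetP[v _ ->] /= ->.
exists true, arcs; split=> //.
- have := in_volume_le; rewrite -/T => Tle.
  have : (2 * T <= 2 * (h.+1 * #|V|) + 2 * #|arcs|)%N by rewrite -mulnDr leq_mul2l.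
  rewrite mulnA mul2n -addnn => T2.
  have : (T <= 2 * #|arcs|)%N.
    by rewrite -(leq_add2l T); apply: leq_trans T2 _; rewrite leq_add2r ltnW.
  by move=> /leq_trans; apply; rewrite -mulnA leq_mul2l /= leq_pmull.
- by move=> yv; rewrite !inE => /and3P[].
- by move=> _ yv; rewrite !inE => /and3P[-> _ ->].
Qed.

End VolumeSplit.

(** * Parameters *)

Section SingleGraph.
Variables (R : realType) (alpha C : R).
Hypotheses (alpha_gt0 : 0 < alpha) (alpha_lt1 : alpha < 1) (C_ge1 : 1 <= C).

Let kappa : R := C / alpha.

(** Threshold for (log n)^(1/4); the largest constant asked of it is 2^32, in
    [2 ^+ 32 * kappa <= alpha ^+ 2 * lam ^+ 6]. *)
Definition lam_min : R := 2 ^+ 33 * kappa / alpha ^+ 2.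

Lemma lam_min_ge : [/\ 1 <= kappa, C <= kappa, 2 ^+ 33 * kappa <= lam_min &
  2 ^+ 33 <= lam_min].
Proof.
have k1 : C <= kappa.
  by rewrite ler_pdivlMr // ler_piMr ?(le_trans ler01) // ltW.
have a2 : alpha ^+ 2 <= 1 by rewrite expr_le1 // ltW.
have k2 : 1 <= kappa by apply: le_trans k1.
have k3 : 2 ^+ 33 * kappa <= lam_min.
  rewrite ler_pdivlMr ?exprn_gt0 // ler_piMr //.
  by rewrite mulr_ge0 ?exprn_ge0 // (le_trans ler01).
split=> //; apply: le_trans k3; rewrite ler_peMr ?exprn_ge0 //.
Qed.

Lemma lam_min_bounds :
  [/\ 2 <= lam_min, C <= lam_min & 2 ^+ 10 <= alpha ^+ 2 * lam_min].
Proof.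
have [k1 Ck klam lam33] := lam_min_ge; split.
- by apply: le_trans lam33; lra.
- apply: le_trans Ck (le_trans _ klam); rewrite ler_peMl ?(le_trans ler01) //; lra.
- rewrite /lam_min mulrC divfK ?expf_neq0 ?lt0r_neq0 //.
  apply: (@le_trans _ _ (2 ^+ 33)); first by lra.
  by rewrite ler_peMr ?exprn_ge0.
Qed.

(** As 2 <= e, the total exponent is at most L + 2 (s + 1) - 8 (s + L) <= -4 for s >= 1, and e^4 >=
    16. *)
Lemma chernoff_bound (eps L : R) (n s M : nat) :
  n%:R = expR L -> 0 <= L -> (0 < s)%N -> 32 * (s%:R + L) <= eps * M%:R ->
  2 * n%:R * (2 ^+ (2 * s.+1) * expR (- (eps * M%:R / 4))) <= 1 / 8.
Proof.
move=> nE L0 s0 M_ge.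
have e2 : 2 <= expR 1 :> R by have := expR_ge1Dx (1 : R); lra.
have two : 2 ^+ (2 * s.+1) <= expR (2 * s.+1%:R) :> R.
  rewrite -natrM -[X in expR X]mulr1 expRM_natl.
  by apply: lerXn2r; rewrite ?nnegrE ?expR_ge0.
have e4 : 16 <= expR 4 :> R.
  rewrite -[X in expR X]mulr1 expRM_natl [16](_ : _ = 2 ^+ 4); last by ring.
  by apply: lerXn2r; rewrite ?nnegrE ?expR_ge0.
have s1 : 1 <= s%:R :> R by rewrite ler1n.
apply: (@le_trans _ _ (2 * (expR L * (expR (2 * s.+1%:R) * expR (- (eps * M%:R / 4)))))).
  by rewrite nE -mulrA ler_pM2l // ler_pM2l ?expR_gt0 // ler_wpM2r ?expR_ge0.
rewrite -!expRD; apply: (@le_trans _ _ (2 * expR (- 4))).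
  by rewrite ler_pM2l // ler_expR -natr1; lra.
rewrite expRN -ler_pdivlMl // -div1r ler_pdivrMr ?expR_gt0 //; lra.
Qed.

Lemma ln_pow_le (n : nat) (L : R) : n%:R = expR L -> 0 <= L ->
  L ^+ 4 <= 256 * n%:R.
Proof.
move=> -> L0; have /(lerXn2r 4) : L / 4 <= expR (L / 4).
  by apply: le_trans (expR_ge1Dx _); lra.
rewrite !nnegrE expR_ge0 divr_ge0 // => /(_ isT isT).
rewrite -expRM_natl -[4%:R * _]/(4 * (L / 4)) mulrCA divff // mulr1.
rewrite expr_div_n ler_pdivrMr ?exprn_gt0 // => /le_trans; apply.
by rewrite mulrC ler_wpM2r ?expR_ge0 // -natrX ler_nat.
Qed.

(* g is h^2 + 1, q is r / pi and y is s + L + 1; the bound on g * lam ^+ 6 says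
   that the allowed running time is at least 1. *)
Lemma gadget_size (eps lam nr g q y : R) :
  0 < eps -> eps <= 1 -> lam_min <= lam -> 0 < nr -> 1 <= g -> 0 < q ->
  g * lam ^+ 6 <= C * q * eps ^+ 2 -> q <= nr / alpha ->
  lam ^+ 16 <= 256 * nr ->
  y <= lam * nr * g / q + 2 * lam ^+ 4 ->
  [/\ 64 * y <= eps ^+ 2 * nr,
      lam ^+ 4 * (1024 * y) <= alpha * eps * nr &
      y * (C * (q * (eps ^+ 2 / g) / lam ^+ 6)) <= 3 * kappa / lam ^+ 2 * (eps * nr)].
Proof.
move=> eps0 eps1 lam_ge n0 g1 q0 time q_le pow y_le.
have [k1 Ck klam lam33] := lam_min_ge.
have lam1 : 1 <= lam by apply: le_trans lam_ge; lra.
have lam0 : 0 < lam by apply: lt_le_trans lam1.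
have alam : 2 ^+ 33 * kappa <= lam by apply: le_trans lam_ge.
have k0 : 0 < kappa by apply: lt_le_trans k1.
have g0 : 0 < g by apply: lt_le_trans g1.
have C0 : 0 < C by apply: lt_le_trans C_ge1.
have en0 : 0 < eps * nr by rewrite mulr_gt0.
have een : eps ^+ 2 * nr <= eps * nr.
  by rewrite expr2 -mulrA ler_piMl // ltW.
(* A time budget of at least 1 together with q <= n / alpha bounds eps^2 n from below. *)
have F2 : lam ^+ 6 <= kappa * (eps ^+ 2 * nr).
  apply: (@le_trans _ _ (g * lam ^+ 6)); first by rewrite ler_peMl // exprn_ge0 // ltW.
  apply: le_trans time _; rewrite -mulrA.
  apply: (@le_trans _ _ (C * (nr / alpha * eps ^+ 2))); last first.
    by rewrite le_eqVlt; apply/orP; left; apply/eqP; rewrite /kappa; ring.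
  by rewrite ler_pM2l // ler_wpM2r // sqr_ge0.
set a := lam * nr * g / q in y_le *.
have a0 : 0 <= a by rewrite divr_ge0 ?(ltW q0) // !mulr_ge0 ?(ltW g0) ?ltW.
(* [a] is the feeder part of [y]; its factor lam completes lam^5 to the lam^6 of [time]. *)
have F3 : lam ^+ 5 * a <= C * (eps ^+ 2 * nr).
  rewrite /a mulrA ler_pdivrMr //.
  have := ler_wpM2r (ltW n0) time; lra.
have lamX i : 1 <= lam ^+ i by rewrite exprn_ege1.
have L2 : lam ^+ 2 * y <= 3 * kappa * (eps ^+ 2 * nr).
  have H1 : lam ^+ 2 * y <= lam ^+ 2 * (a + 2 * lam ^+ 4).
    by rewrite ler_wpM2l // exprn_ge0 // ltW.
  have H2 : lam ^+ 2 * a <= lam ^+ 5 * a.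
    by rewrite ler_wpM2r // ler_weXn2l.
  have H3 : C * (eps ^+ 2 * nr) <= kappa * (eps ^+ 2 * nr).
    by rewrite ler_wpM2r // mulr_ge0 ?sqr_ge0 // ltW.
  by move: H1 H2 H3 F3 F2; lra.
split.
- have H : 192 * kappa <= lam ^+ 2.
    rewrite expr2; apply: (@le_trans _ _ lam); last by rewrite ler_peMl // ltW.
    by move: alam; lra.
  have e0 : 0 <= eps ^+ 2 * nr by rewrite mulr_ge0 ?sqr_ge0 // ltW.
  have l20 : 0 < lam ^+ 2 by rewrite exprn_gt0.
  by rewrite -(ler_pM2l l20); have := ler_wpM2r e0 H; move: L2; lra.
(* The feeder part 1024 a and the logarithmic part 2048 lam^4 of 1024 y each get half of the
   right-hand side. *)
- have H1 : lam ^+ 4 * a * 2048 <= alpha * (eps * nr).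
    rewrite -(ler_pM2l lam0).
    have K : C * 2048 <= alpha * lam.
      rewrite -[C](_ : alpha * kappa = _); last first.
        by rewrite /kappa mulrC divfK // lt0r_neq0.
      by rewrite -mulrA ler_pM2l //; move: alam k0; lra.
    have := ler_wpM2r (ltW en0) K; move: F3.
    have : C * (eps ^+ 2 * nr) <= C * (eps * nr) by rewrite ler_pM2l.
    by lra.
  have H2 : 4096 * lam ^+ 8 <= alpha * (eps * nr).
    (* [F2] controls eps^2 n rather than eps n, hence the squaring: [F2] times [pow] has (eps n)^2
       on the right. *)
    rewrite -(@ler_pXn2r _ 2) // ?nnegrE; last 2 first.
    - by rewrite mulr_ge0 ?ler0n ?exprn_ge0 ?(ltW lam0).
    - by rewrite mulr_ge0 ?(ltW alpha_gt0) ?(ltW en0).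
    have K : 2 ^+ 32 * kappa <= alpha ^+ 2 * lam ^+ 6.
      rewrite -ler_pdivrMl ?exprn_gt0 // mulrC.
      apply: (@le_trans _ _ lam); last by rewrite exprS ler_peMr // ltW.
      apply: le_trans lam_ge; rewrite ler_wpM2r ?invr_ge0 ?exprn_ge0 ?(ltW alpha_gt0) //.
      rewrite ler_wpM2r ?(ltW k0) //; lra.
    have P16 : 0 < lam ^+ 16 by rewrite exprn_gt0.
    have K1 := ler_wpM2r (ltW P16) K.
    have K2 : alpha ^+ 2 * lam ^+ 6 * lam ^+ 16 <=
        alpha ^+ 2 * (kappa * (eps ^+ 2 * nr) * (256 * nr)).
      rewrite -mulrA ler_wpM2l ?sqr_ge0 //.
      by rewrite ler_pM // exprn_ge0 // ltW.
    have k256 : 0 < 256 * kappa by rewrite pmulr_rgt0 ?ltr0n.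
    by rewrite -(ler_pM2l k256); move: K1 K2; lra.
  have H3 : lam ^+ 4 * (1024 * y) <= lam ^+ 4 * (1024 * (a + 2 * lam ^+ 4)).
    by rewrite ler_wpM2l ?exprn_ge0 ?(ltW lam0) ?ler_wpM2l ?ler0n.
  by move: H1 H2 H3; lra.
- rewrite [leRHS]mulrAC ler_pdivlMr ?exprn_gt0 //.
  set z := C * _.
  have z0 : 0 <= z.
    by rewrite /z !mulr_ge0 ?divr_ge0 ?invr_ge0 ?exprn_ge0 ?(ltW q0) ?ltW.
  have zE : z * (g * lam ^+ 6) = C * q * eps ^+ 2.
    by rewrite /z; field; rewrite !lt0r_neq0 ?exprn_gt0.
  have z_le : z * lam ^+ 6 <= kappa * (eps ^+ 2 * nr).
    apply: (@le_trans _ _ (C * q * eps ^+ 2)).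
      by rewrite -zE ler_wpM2l // ler_peMl ?exprn_ge0 ?(ltW lam0).
    rewrite -mulrA; apply: (@le_trans _ _ (C * (nr / alpha * eps ^+ 2))); last first.
      by rewrite le_eqVlt; apply/orP; left; apply/eqP; rewrite /kappa; ring.
    by rewrite ler_pM2l // ler_wpM2r // sqr_ge0.
  have az : a * z * lam ^+ 5 = C * (eps ^+ 2 * nr).
    by rewrite /a /z; field; rewrite !lt0r_neq0 ?exprn_gt0.
  have H1 : y * z * lam ^+ 2 <= (a + 2 * lam ^+ 4) * z * lam ^+ 2.
    by rewrite ler_wpM2r ?exprn_ge0 ?(ltW lam0) // ler_wpM2r.
  have H2 : a * z * lam ^+ 2 <= a * z * lam ^+ 5.
    by apply: ler_wpM2l; [rewrite mulr_ge0|rewrite ler_weXn2l].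
  have H3 : C * (eps ^+ 2 * nr) <= kappa * (eps ^+ 2 * nr).
    by rewrite ler_wpM2r // mulr_ge0 ?sqr_ge0 // ltW.
  have H4 : kappa * (eps ^+ 2 * nr) <= kappa * (eps * nr) by rewrite ler_pM2l.
  by move: H1 H2 H3 H4 az z_le; lra.
Qed.

End SingleGraph.

Lemma scaled_rewiring (R : realType) (alpha C : R) (n : nat) (G : digraph n)
    (t : 'I_n) (eps r : R) (h : nat) (A : algorithm R n) (lam : R) :
  let T := in_volume alpha G r t in let pr := pagerank alpha G t in
  0 < alpha -> alpha < 1 -> 1 <= C -> 0 <= eps <= 1 -> 0 <= r <= 1 ->
  (#|[pred v | ((1 - eps) * n%:R < (indeg G v)%:R)%R
            || ((1 - eps) * n%:R < (outdeg G v)%:R)%R]| <= h)%N ->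
  n%:R = expR (lam ^+ 4) ->
  lam_min alpha C <= lam ->
  (expected_time A G <= (C * (Num.min T%:R (r / pr)
     * (eps ^+ 2 / (h%:R ^+ 2 + 1)) / lam ^+ 6))%:E)%E ->
  exists G' : digraph n,
    lam * (alpha * (1 - alpha) ^+ 2 / 8) * pr <= pagerank alpha G' t /\
    ((1 - 1552 * (C / alpha) / lam)%:E <= same_output_prob A G' G)%E.
Proof.
move=> T pr alpha_gt0 alpha_lt1 C_ge1 eps01 r01 hdeg nE lam_ge timeE.
have [k1 Ck _ _] := lam_min_ge alpha_gt0 alpha_lt1 C_ge1.
have [lam2 C_lam a2_lam] : [/\ 2 <= lam, C <= lam & 2 ^+ 10 <= alpha ^+ 2 * lam].
  have [min2 Cmin amin] := lam_min_bounds alpha_gt0 alpha_lt1 C_ge1.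
  split; [exact: le_trans lam_ge|exact: le_trans lam_ge|].
  by apply: le_trans amin _; rewrite ler_wpM2l ?sqr_ge0.
set kappa := C / alpha in k1 Ck *.
have lam1 : 1 <= lam by apply: le_trans lam2; rewrite ler1n.
have lam0 : 0 < lam by apply: lt_le_trans lam1.
have lamX i : 1 <= lam ^+ i by rewrite exprn_ege1.
have lamX0 i : 0 < lam ^+ i by rewrite exprn_gt0.
have C0 : 0 < C by apply: lt_le_trans C_ge1.
have [L LE] : exists L, L = lam ^+ 4 by exists (lam ^+ 4).
rewrite -LE in nE.
have n_gt0 : (0 < n)%N by apply: leq_ltn_trans (ltn_ord t).
have nR : 0 < n%:R :> R by rewrite ltr0n.
have pr_ge : alpha / n%:R <= pr := pagerank_ge G t alpha_gt0 alpha_lt1.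
have pr_gt0 : 0 < pr by apply: lt_le_trans pr_ge; rewrite divr_gt0.
pose q := r / pr; pose g : R := h%:R ^+ 2 + 1.
have g1 : 1 <= g by rewrite lerDr sqr_ge0.
have g0 : 0 < g by apply: lt_le_trans g1.
have /andP[eps_ge0 eps_le1] := eps01; have /andP[r_ge0 r_le1] := r01.
have e21 : eps ^+ 2 <= 1 by rewrite expr_le1.
pose F := eps ^+ 2 / g.
have F_ge0 : 0 <= F by rewrite divr_ge0 ?sqr_ge0 // ltW.
set E := C * _ in timeE.
have E_le X : Num.min T%:R q <= X -> E <= C * (X * F / lam ^+ 6).
  move=> X_le; rewrite /E -/q -/g -/F; apply: ler_wpM2l; first exact: ltW.
  by apply: ler_wpM2r; [rewrite invr_ge0 ltW|apply: ler_wpM2r].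
have E_ge1 : 1 <= E.
  rewrite -lee_fin; apply: le_trans timeE; rewrite expected_time_asking.
  by rewrite leeDl // nneseries_ge0.
have Eq : E <= C * (q * F / lam ^+ 6) by apply: E_le; rewrite ge_min lexx orbT.
have ET : E <= C * (T%:R * F / lam ^+ 6) by apply: E_le; rewrite ge_min lexx.
have q_ge0 : 0 <= q by rewrite divr_ge0 // ltW.
clearbody E.
(* The time bound is at least 1, so none of its factors vanishes; this excludes eps = 0, r = 0 and T
   = 0. *)
have nonzero X : X = 0 -> ~ E <= C * X.
  by move=> -> /(le_trans E_ge1); rewrite mulr0 ler10.
have F0 : 0 < F.
  rewrite lt_neqAle F_ge0 andbT eq_sym; apply/eqP => F0.
  by apply: nonzero Eq; rewrite F0 mulr0 mul0r.
have q0 : 0 < q.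
  rewrite lt_neqAle q_ge0 andbT eq_sym; apply/eqP => q0.
  by apply: nonzero Eq; rewrite q0 !mul0r.
have T0 : (0 < T)%N.
  rewrite lt0n; apply/eqP => T0; by apply: nonzero ET; rewrite T0 !mul0r.
have TR : 0 < T%:R :> R by rewrite ltr0n.
have eps0 : 0 < eps.
  rewrite lt_neqAle eps_ge0 andbT eq_sym; apply/eqP => e0.
  by move: F0; rewrite /F e0 expr0n mul0r ltxx.
have r0 : 0 < r by rewrite -(pmulr_lgt0 _ (_ : 0 < pr^-1)) // invr_gt0.
have time : g * lam ^+ 6 <= C * q * eps ^+ 2.
  have : 1 <= C * (q * F / lam ^+ 6) by apply: le_trans Eq.
  rewrite (_ : C * _ = C * q * eps ^+ 2 / (g * lam ^+ 6)); last first.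
    by rewrite /F; field; rewrite !lt0r_neq0.
  by rewrite ler_pdivlMr ?mulr_gt0 // mul1r.
have q_le : q <= n%:R / alpha.
  rewrite /q ler_pdivrMr //; apply: le_trans r_le1 _.
  by rewrite mulrAC ler_pdivlMr // mul1r mulrC -ler_pdivrMr.
have pow : lam ^+ 16 <= 256 * n%:R.
  rewrite (_ : 16 = 4 * 4)%N // exprM -LE; apply: ln_pow_le nE _.
  by rewrite LE ltW.
(* Since r = q pr, this makes (s / n)(r / g) at least lam pr. *)
pose s := (Num.trunc (lam * n%:R * g / q)).+1.
have s_ge : lam * n%:R * g / q <= s%:R by rewrite ltW // Num.Theory.truncnS_gt.
have a_ge0 : 0 <= lam * n%:R * g / q.
  apply: divr_ge0; last exact: ltW.
  by apply: mulr_ge0; [apply: mulr_ge0|]; rewrite ?ler0n // ltW.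
have s_le : s%:R <= lam * n%:R * g / q + 1.
  by rewrite -natr1 lerD2r Num.Theory.truncn_le.
(* The extra 1 pays for rounding: eps (M + 1) stays below 32 y. *)
pose y := s%:R + L + 1.
have lam44 : 2 <= lam ^+ 4.
  by apply: le_trans lam2 _; rewrite -[leLHS]expr1 ler_weXn2l.
have s0 : (0 < s)%N by [].
clearbody s.
have y_le : y <= lam * n%:R * g / q + 2 * lam ^+ 4.
  by rewrite /y LE; move: s_le lam44; clear; lra.
have [size1 size2 size3] := gadget_size alpha_gt0 alpha_lt1 C_ge1 eps0 eps_le1
  lam_ge nR g1 q0 time q_le pow y_le.
have L0 : 0 <= L by rewrite LE ltW.
pose M := Num.trunc (32 * (s%:R + L) / eps).
have x_ge0 : 0 <= 32 * (s%:R + L) / eps.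
  by rewrite divr_ge0 // mulr_ge0 ?ler0n // addr_ge0.
have M_gt : 32 * (s%:R + L) <= eps * M.+1%:R.
  by rewrite [leRHS]mulrC -ler_pdivrMr // ltW // Num.Theory.truncnS_gt.
have M_le : eps * M.+1%:R <= 32 * y.
  have : M%:R <= 32 * (s%:R + L) / eps by rewrite Num.Theory.truncn_le.
  by rewrite ler_pdivlMr // /y -natr1; move: eps_le1; clear; lra.
have sM : (s <= M)%N.
  rewrite Num.Theory.truncn_ge_nat // ler_pdivlMr //.
  apply: (@le_trans _ _ s%:R); first by rewrite ler_piMr.
  by have : 0 <= s%:R :> R by []; move: L0; clear; lra.
clearbody M.
have M_le2 : M.+1%:R <= eps * n%:R / 2.
  rewrite -(ler_pM2l eps0) (le_trans M_le) //.
  by move: size1; rewrite expr2; clear; lra.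
have chern := chernoff_bound nE L0 s0 M_gt.
pose l := (Num.trunc (2 * L / alpha)).+1.
have l_ge : 2 * L <= alpha * l%:R.
  by rewrite [leRHS]mulrC -ler_pdivrMr // ltW // Num.Theory.truncnS_gt.
have l_le : alpha * l.+1%:R <= 4 * lam ^+ 4.
  have : (Num.trunc (2 * L / alpha))%:R <= 2 * L / alpha.
    by rewrite Num.Theory.truncn_le divr_ge0 ?mulr_ge0 // ltW.
  rewrite ler_pdivlMr // (_ : l.+1%:R = (Num.trunc (2 * L / alpha))%:R + 2).
    by move: alpha_lt1 lam44; rewrite -LE; clear; lra.
  by rewrite /l -addn2 natrD.
clearbody l.
pose m := (n %/ M.+1)%N.
have lm : (8 * l.+1 <= m)%N.
  rewrite leq_divRL // -(ler_nat R) !natrM.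
  rewrite -(ler_pM2l (mulr_gt0 alpha_gt0 eps0)); apply: le_trans size2.
  have : (alpha * l.+1%:R) * (eps * M.+1%:R) <= (4 * lam ^+ 4) * (32 * y).
    by rewrite ler_pM // mulr_ge0 // ltW.
  by clear; lra.
(* The left side is at most exp(-2L) = n^(-2), while the time bound forces q >= 1 and so r >= pr >=
   alpha / n. *)
have tail : (1 - alpha) ^+ l <= alpha * r / 2.
  apply: (@le_trans _ _ (expR (- (2 * L)))).
    apply: (@le_trans _ _ (expR (- alpha) ^+ l)).
      apply: lerXn2r; rewrite ?nnegrE ?expR_ge0 ?subr_ge0 ?(ltW alpha_lt1) //.
      by apply: le_trans (expR_ge1Dx _); rewrite lexx.
    by rewrite -expRM_natl ler_expR mulrN lerN2 [leRHS]mulrC.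
  have an : 4 <= alpha ^+ 2 * n%:R.
    have : lam <= lam ^+ 16 by rewrite -[leLHS]expr1 ler_weXn2l.
    move=> /le_trans/(_ pow)/(ler_wpM2l (sqr_ge0 alpha))/(le_trans a2_lam).
    rewrite mulrCA (_ : 2 ^+ 10 = 256 * 4); last by ring.
    by rewrite ler_pM2l ?ltr0n.
  have q1 : 1 <= q.
    have Clam : C <= lam ^+ 6.
      by apply: le_trans C_lam _; rewrite -[leLHS]expr1 ler_weXn2l.
    have gl : lam ^+ 6 <= g * lam ^+ 6 by rewrite ler_peMl // ltW.
    have Cq : C * q * eps ^+ 2 <= C * q.
      by apply: ler_piMr => //; rewrite mulr_ge0 ?(ltW C0).
    by rewrite -(ler_pM2l C0) mulr1; move: Clam gl Cq time; clear; lra.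
  have r_ge : alpha / n%:R <= r.
    apply: le_trans pr_ge _.
    by rewrite -[r](divfK (lt0r_neq0 pr_gt0)) -/q ler_peMl // ltW.
  apply: (@le_trans _ _ (alpha * (alpha / n%:R) / 2)); last first.
    by rewrite ler_pM2r ?invr_gt0 // ler_pM2l.
  rewrite expRN expRM_natl -nE -div1r ler_pdivrMr ?exprn_gt0 //.
  rewrite [leRHS](_ : _ = alpha ^+ 2 * n%:R / 2); last by field; rewrite lt0r_neq0.
  by move: an; clear; lra.
have [G' [prG' sopG']] := finite_rewiring alpha_gt0 alpha_lt1 hdeg sM M_le2
  chern lm r0 tail T0 timeE.
have rE : r = q * pr by rewrite divfK // lt0r_neq0.
exists G'; split.
  apply: le_trans prG'.
  rewrite [leLHS](_ : _ = (lam * n%:R * g / q) / n%:R *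
      ((1 - alpha) ^+ 2 / (2 * g)) * (alpha * r / 4)); last first.
    by rewrite rE; field; rewrite !lt0r_neq0.
  apply: ler_wpM2r; first by rewrite divr_ge0 ?mulr_ge0 ?(ltW alpha_gt0).
  rewrite expr_div_n; apply: ler_pM => //.
  - by rewrite divr_ge0 // ltW.
  - by rewrite divr_ge0 ?sqr_ge0 // mulr_ge0 // ltW.
  - by rewrite ler_pM2r // invr_gt0.
  apply: ler_wpM2l; first exact: sqr_ge0.
  (* (h + 1)^2 <= 2 (h^2 + 1); this 2 and the 4 in alpha r / 4 make the 8 of the conclusion. *)
  rewrite lef_pV2 ?posrE ?exprn_gt0 ?mulr_gt0 ?ltr0n // -natr1 /g.
  by have := sqr_ge0 (h%:R - 1 : R); have := sqr_ge0 (h%:R : R); clear; lra.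
apply: le_trans sopG'; rewrite lee_fin lerD2l lerN2 -/m.
have y_ge0 : 0 <= y by rewrite /y !addr_ge0.
have m0 : (0 < m)%N by apply: leq_trans lm.
have mR : 0 < m%:R :> R by rewrite ltr0n.
have en : 0 < eps * n%:R by rewrite mulr_gt0.
(* As m >= 1, rounding n / (M + 1) down loses at most a factor 2. *)
have n_lt : n%:R <= 2 * m%:R * M.+1%:R :> R.
  rewrite -!natrM ler_nat; apply: ltnW.
  apply: leq_trans (ltn_ceil n (ltn0Sn M)) _.
  rewrite -/m leq_mul2r; apply/orP; right.
  by rewrite mul2n -addnn -[X in (X <= _)%N]addn1 leq_add2l.
have m_inv : eps * n%:R * (1 / m%:R) <= 64 * y.
  rewrite mul1r ler_pdivrMr //.
  have := ler_wpM2l (ltW eps0) n_lt; have := ler_wpM2l (ltW mR) M_le; clear; lra.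
have E1 : 1 / m%:R * E <= 192 * kappa / lam ^+ 2.
  rewrite -(ler_pM2l en) mulrA.
  apply: (@le_trans _ _ (64 * y * E)); first by rewrite ler_wpM2r // (le_trans ler01).
  have := ler_wpM2l y_ge0 Eq; move: size3; rewrite -/F -/kappa; clear; lra.
have hF : h.+1%:R * F <= 2.
  rewrite /F mulrA ler_pdivrMr //.
  have : h.+1%:R * eps ^+ 2 <= h.+1%:R by apply: ler_piMr.
  by rewrite -[h.+1%:R]natr1 /g; have := sqr_ge0 (h%:R - 1 : R); have := sqr_ge0 (h%:R : R); clear; lra.
have E2 : h.+1%:R / T%:R * E <= 2 * kappa / lam ^+ 2.
  apply: (@le_trans _ _ (h.+1%:R / T%:R * (C * (T%:R * F / lam ^+ 6)))).
    by rewrite ler_wpM2l // divr_ge0.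
  rewrite [leLHS](_ : _ = C * (h.+1%:R * F) / lam ^+ 6); last first.
    by field; rewrite !lt0r_neq0.
  have hF_ge0 : 0 <= h.+1%:R * F by rewrite mulr_ge0.
  apply: ler_pM.
  - by apply: mulr_ge0; first exact: ltW.
  - by rewrite invr_ge0 ltW.
  - by rewrite [leRHS]mulrC ler_pM // ltW.
  - by rewrite lef_pV2 ?posrE // ler_weXn2l.
have E3 : kappa / lam ^+ 2 <= kappa / lam.
  apply: ler_wpM2l; first exact: le_trans k1.
  by rewrite lef_pV2 ?posrE // -[leLHS]expr1 ler_weXn2l.
(* 1552 = 8 (192 + 2). *)
by move: E1 E2 E3; clear; lra.
Qed.

(** With the fourth root of log n as parameter, log n and its power 3/2 are the integer powers lam^4
    and lam^6. *)
Lemma single_rewiring (R : realType) (alpha C : R) (n : nat) (G : digraph n)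
    (t : 'I_n) (eps r : R) (h : nat) (A : algorithm R n) :
  let T := in_volume alpha G r t in let pr := pagerank alpha G t in
  let lam := Num.sqrt (Num.sqrt (ln (n%:R : R))) in
  0 < alpha -> alpha < 1 -> 1 <= C -> 0 <= eps <= 1 -> 0 <= r <= 1 ->
  (#|[pred v | ((1 - eps) * n%:R < (indeg G v)%:R)%R
            || ((1 - eps) * n%:R < (outdeg G v)%:R)%R]| <= h)%N ->
  lam_min alpha C <= lam ->
  (expected_time A G <= (C * (Num.min T%:R (r / pr)
     * (eps ^+ 2 / (h%:R ^+ 2 + 1)) / (ln n%:R `^ (3 / 2))))%:E)%E ->
  exists G' : digraph n,
    lam * (alpha * (1 - alpha) ^+ 2 / 8) * pr <= pagerank alpha G' t /\
    ((1 - 1552 * (C / alpha) / lam)%:E <= same_output_prob A G' G)%E.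
Proof.
move=> T pr lam alpha_gt0 alpha_lt1 C_ge1 eps01 r01 hdeg lam_ge timeE.
have [lam2 _ _] := lam_min_bounds alpha_gt0 alpha_lt1 C_ge1.
have lam0 : 0 < lam by apply: lt_le_trans lam_ge; apply: lt_le_trans lam2.
have ln_gt0 : 0 < ln (n%:R : R) by rewrite -sqrtr_gt0 -sqrtr_gt0.
have LE : ln n%:R = lam ^+ 4.
  by rewrite /lam (_ : 4 = 2 * 2)%N // exprM !sqr_sqrtr // ltW // sqrtr_gt0.
have nR : 0 < n%:R :> R by rewrite ltr0n; apply: leq_ltn_trans (ltn_ord t).
apply: (@scaled_rewiring _ _ C _ _ _ eps r h) => //; first by rewrite -LE lnK // posrE.
have lam_ge0 := ltW lam0.
suff -> : lam ^+ 6 = ln n%:R `^ (3 / 2) by [].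
have -> : ln n%:R = lam `^ 4%:R by rewrite powR_mulrn.
by rewrite -powR_mulrn // -powRrM; congr (_ `^ _); field.
Qed.

Theorem theorem5p1 (R : realType) (alpha : R) (halpha : 0 < alpha < 1)
  (n : nat -> nat) (hn : n @ \oo --> \oo)
  (G : forall k : nat, digraph (n k)) (t : forall k : nat, 'I_(n k))
  (eps : nat -> R) (heps : forall k, 0 <= eps k <= 1)
  (h : nat -> nat)
  (hdeg : forall k,
    (#|[pred v | ((1 - eps k) * (n k)%:R < (indeg (G k) v)%:R)%R
              || ((1 - eps k) * (n k)%:R < (outdeg (G k) v)%:R)%R]|
       <= h k)%N)
  (r : nat -> R) (hr : forall k, 0 <= r k <= 1)
  (A : forall m : nat, 'I_m -> algorithm R m)
  (htime : exists C : R, \forall k \near \oo,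
    (expected_time (A (n k) (t k)) (G k) <=
      (C * (Num.min (in_volume alpha (G k) (r k) (t k))%:R
                    (r k / pagerank alpha (G k) (t k))
            * (eps k ^+ 2 / ((h k)%:R ^+ 2 + 1))
            / (ln (n k)%:R `^ (3 / 2))))%:E)%E) :
  exists Gp : forall k : nat, digraph (n k),
    ((fun k => pagerank alpha (G k) (t k)) =o_\oo
     (fun k => pagerank alpha (Gp k) (t k))) /\
    exists2 delta : nat -> R, delta @ \oo --> 0 &
      forall k, ((1 - delta k)%:E <=
                 same_output_prob (A (n k) (t k)) (Gp k) (G k))%E.
Proof.
case/andP: halpha => alpha_gt0 alpha_lt1; case: htime => C0 htimeC.
pose C := Num.max C0 1.
have C_ge1 : 1 <= C by rewrite le_max lexx orbT.
pose lam k : R := Num.sqrt (Num.sqrt (ln (n k)%:R)).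
have lam_ge0 k : 0 <= lam k by apply: sqrtr_ge0.
pose ok k : Prop := lam_min alpha C <= lam k /\
    (expected_time (A (n k) (t k)) (G k) <=
      (C * (Num.min (in_volume alpha (G k) (r k) (t k))%:R
                    (r k / pagerank alpha (G k) (t k))
            * (eps k ^+ 2 / ((h k)%:R ^+ 2 + 1))
            / (ln (n k)%:R `^ (3 / 2))))%:E)%E.
have lam_large B : \forall k \near \oo, B <= lam k.
  have [N N_ge] : exists N : nat, expR (Num.max B 0 ^+ 4) <= N%:R.
    exists (Num.trunc (expR (Num.max B 0 ^+ 4))).+1.
    by rewrite ltW // Num.Theory.truncnS_gt.
  have : \forall k \near \oo, (N <= n k)%N.
    by move/cvgnyPge: hn; apply.
  apply: filterS => k Nk; apply: (@le_trans _ _ (Num.max B 0)).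
    by rewrite le_max lexx.
  set b := Num.max B 0 in N_ge *; have b_ge0 : 0 <= b by rewrite le_max lexx orbT.
  have b4 : b ^+ 4 <= ln (n k)%:R.
    rewrite -[leLHS]expRK ler_ln ?posrE ?expR_gt0 //.
      by apply: le_trans N_ge _; rewrite ler_nat.
    by apply: lt_le_trans (expR_gt0 (b ^+ 4)) (le_trans N_ge _); rewrite ler_nat.
  rewrite -[b]ger0_norm // -sqrtr_sqr ler_wsqrtr //.
  rewrite -[b ^+ 2]ger0_norm ?sqr_ge0 // -sqrtr_sqr ler_wsqrtr //.
  by rewrite -exprM.
have ok_near : \forall k \near \oo, ok k.
  near=> k; split; first by near: k; apply: lam_large.
  have timek : (expected_time (A (n k) (t k)) (G k) <= (C0 *
      (Num.min (in_volume alpha (G k) (r k) (t k))%:R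
               (r k / pagerank alpha (G k) (t k))
       * (eps k ^+ 2 / ((h k)%:R ^+ 2 + 1)) / (ln (n k)%:R `^ (3 / 2))))%:E)%E.
    by near: k.
  apply: le_trans timek _; rewrite lee_fin ler_wpM2r ?le_max ?lexx //.
  have /andP[r_ge0 _] := hr k.
  rewrite divr_ge0 ?powR_ge0 // mulr_ge0 ?divr_ge0 ?sqr_ge0 ?addr_ge0 ?sqr_ge0 //.
  rewrite le_min ler0n divr_ge0 //.
  apply: le_trans (pagerank_ge (G k) (t k) alpha_gt0 alpha_lt1).
  by rewrite divr_ge0 // ltW.
pose c := alpha * (1 - alpha) ^+ 2 / 8.
have c_gt0 : 0 < c by rewrite divr_gt0 // mulr_gt0 // exprn_gt0 // subr_gt0.
have [D [D_ge0 DE]] : exists D, 0 <= D /\ D = 1552 * (C / alpha).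
  exists (1552 * (C / alpha)); split; last by [].
  by rewrite mulr_ge0 ?ler0n ?divr_ge0 ?(ltW alpha_gt0) ?(le_trans ler01 C_ge1).
have rewired k : exists G' : digraph (n k), ok k ->
    lam k * c * pagerank alpha (G k) (t k) <= pagerank alpha G' (t k) /\
    ((1 - D / lam k)%:E <=
       same_output_prob (A (n k) (t k)) G' (G k))%E.
  have [[lam_k time_k]|nok] := pselect (ok k); last by exists (G k).
  have [G' H] := single_rewiring alpha_gt0 alpha_lt1 C_ge1 (heps k) (hr k)
    (hdeg k) lam_k time_k.
  by rewrite DE; exists G'.
pose Gp k := projT1 (cid (rewired k)).
have GpP k : ok k -> _ := projT2 (cid (rewired k)).
have pr_ge0 (k : nat) (G' : digraph (n k)) : 0 <= pagerank alpha G' (t k).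
  apply: le_trans (pagerank_ge G' (t k) alpha_gt0 alpha_lt1).
  by rewrite divr_ge0 // ltW.
have lam_pos B : 0 < B -> \forall k \near \oo, B <= lam k /\ 0 < lam k.
  move=> B_gt0; apply: filterS (lam_large B) => k Bk; split=> //.
  exact: lt_le_trans Bk.
exists Gp; split.
  apply/eqoP => e e_gt0; near=> k.
  have okk : ok k by near: k; apply: ok_near.
  have [le1 _] := GpP k okk.
  rewrite !ger0_norm //; apply: (@le_trans _ _
    (e * (lam k * c * pagerank alpha (G k) (t k)))); last by rewrite ler_pM2l.
  rewrite [leRHS](_ : _ =
    lam k * (e * c) * pagerank alpha (G k) (t k)); last by ring.
  rewrite ler_peMl //.
  have : (e * c)^-1 <= lam k.
    by near: k; apply: lam_large.
  have ec_gt0 : 0 < e * c by apply: mulr_gt0.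
  by rewrite -div1r ler_pdivrMr.
(* Where [ok] fails, delta = 1 makes the bound trivial; [ok] holds for all large k, so the limit is
   unaffected. *)
exists (fun k => if `[< ok k >] then D / lam k else 1).
  apply/cvgrPdist_le => e e_gt0.
  have De_ge0 : 0 <= D / e by apply: divr_ge0; last exact: ltW.
  near=> k.
  have okk : ok k by near: k; apply: ok_near.
  rewrite asboolT // sub0r normrN.
  rewrite ger0_norm ?divr_ge0 //.
  have [le1 lam_k0] : D / e + 1 <= lam k /\ 0 < lam k.
    by near: k; apply: lam_pos; apply: ltr_wpDl.
  rewrite ler_pdivrMr // mulrC -ler_pdivrMr //.
  by apply: le_trans le1; rewrite lerDl.
move=> k; case: asboolP => [okk|_]; first by have [_] := GpP k okk.
by rewrite subrr /same_output_prob measure_ge0.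
Unshelve. all: by end_near.
Qed.
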